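(* Suppose $\mathcal X$ is $p$-convex and uniformly smooth and $\mathcal Y$ is uniformly smooth. Suppose the operators $F_i$, $i=1,\dots,N$, satisfy conditions (i)-(iii) of the context with $x^\dagger$ the $x_0$-minimum-distance solution, radius $\nu>0$, a closed and convex set $\mathcal S$ and constants $L_{\max}$, $\gamma\in(0,1)$. Let $x_0\in\mathcal B_\nu(x^\dagger)$, and let the step-sizes $\mu_k>0$ satisfy $\sum_{k=1}^\infty\mu_k=\infty$ and, for some constant $C>0$, $$1-\gamma-L_{\max}^{p^*}\frac{G_{p^*}}{p^*}\mu_k^{p^*-1}\ge C>0\quad\text{for all }k\in\mathbb N .$$ Assume further that $F$ is weak-to-weak continuous and $\operatorname{null}(F'(x^\dagger))\subset\operatorname{null}(F'(x))$ for all $x\in\mathcal S$. Let $(x_k)_{k\in\mathbb N}$ be the SGD iterates for exact data defined in the context. Then $$\lim_{k\to\infty}\mathbb E[\mathbf B_p(x_k,x^\dagger)]=0 .$$ Moreover, for $1\le r\le p$, $$\lim_{k\to\infty}\mathbb E[\|x_k-x^\dagger\|_{\mathcal X}^r]=0\quad\text{and}\quad\lim_{k\to\infty}\mathbb E\big[\|\mathcal J_p^{\mathcal X}(x_k)-\mathcal J_p^{\mathcal X}(x^\dagger)\|_{\mathcal X^*}^{p^*}\big]=0 .$$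
   Context: Spaces. $\mathcal X,\mathcal Y_1,\dots,\mathcal Y_N$ are real Banach spaces; $\mathcal Y=\mathcal Y_1\times\cdots\times\mathcal Y_N$ carries the $\ell^s$-norm of $(\|y_1\|_{\mathcal Y_1},\dots,\|y_N\|_{\mathcal Y_N})$ for a fixed $s\ge1$. $p>1$ and $1/p+1/p^*=1$. $\mathcal X$ is $p$-convex if there is $K_p>0$ with $\inf\{1-\tfrac12\|z+w\|:\|z\|=\|w\|=1,\|z-w\|\ge\tau\}\ge K_p\tau^p$ for all $\tau\in(0,2]$. A space is uniformly smooth if $\rho(\tau)/\tau\to0$ as $\tau\searrow0$, where $\rho(\tau)=\sup\{\tfrac12(\|z+\tau w\|+\|z-\tau w\|)-1:\|z\|=\|w\|=1\}$. Duality map. $\mathcal J_p^{\mathcal X}(x)=\{x^*\in\mathcal X^*:\langle x^*,x\rangle=\|x\|\|x^*\|,\ \|x^*\|=\|x\|^{p-1}\}$. For $\mathcal X$ $p$-convex and uniformly smooth it is single-valued and invertible with inverse $\mathcal J_{p^*}^{\mathcal X^*}$. $\jmath_p$ denotes a single-valued selection of the analogous duality map (gauge $t\mapsto t^{p-1}$) on $\mathcal Y_i$. Bregman distance. $\mathbf B_p(z,w)=\frac1{p^*}\|z\|^p+\frac1p\|w\|^p-\langle\mathcal J_p^{\mathcal X}(z),w\rangle$ on $\mathcal X$; analogously $\mathbf B_{p^*}(z^*,w^* )=\frac1p\|z^*\|^{p^*}+\frac1{p^*}\|w^*\|^{p^*}-\langle\mathcal J_{p^*}^{\mathcal X^*}(z^*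 ),w^*\rangle$ on $\mathcal X^*$. $G_{p^*}>0$ is a constant (it exists since $\mathcal X^*$ is $p^*$-smooth) with $\mathbf B_{p^*}(z^*,w^* )\le\frac{G_{p^*}}{p^*}\|w^*-z^*\|^{p^*}$ for all $z^*,w^*\in\mathcal X^*$. $\mathcal B_\nu(x)=\{z\in\mathcal X:\mathbf B_p(z,x)\le\nu\}$. Problem. $F_i:\mathcal D(F_i)\subset\mathcal X\to\mathcal Y_i$, $F=(F_1,\dots,F_N)$, $\mathcal D(F)=\cap_i\mathcal D(F_i)$, exact data $y=(y_1,\dots,y_N)$. Conditions on $F$. $\mathcal S\subset\mathcal D(F)$ is closed and convex, and: (i) there are a solution $x^\dagger$ of $F(x)=y$ and $\nu>0$ with $\mathcal B_\nu(x^\dagger)\subset\mathcal S$; (ii) each $F_i$ is Fréchet differentiable in $\mathcal S$ with $\|F_i'(x)\|\le L_i$ for all $x\in\mathcal S$, and $L_{\max}=\max_iL_i$; (iii) there is $0<\gamma<1$ with $\|F_i(x)-F_i(\tilde x)-F_i'(x)(x-\tilde x)\|_{\mathcal Y_i}\le\gamma\|F_i(x)-F_i(\tilde x)\|_{\mathcal Y_i}$ for all $x,\tilde x\in\mathcal S$ and all $i$. Minimum-distance solution. The $x_0$-minimum-distance solution is $x^\dagger\in\mathcal S$ with $F(x^\dagger)=y$ and $\mathbf B_p(x_0,x^\dagger)=\inf\{\mathbf B_p(x_0,x):F(x)=y,\ x\in\mathcal S\}$. SGD. With deterministic $x_0$ and indices $i_1,i_2,\dots$ drawn independently and uniformly from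 $\{1,\dots,N\}$, $x_{k+1}=\mathcal J_{p^*}^{\mathcal X^*}\big(\mathcal J_p^{\mathcal X}(x_k)-\mu_{k+1}F_{i_{k+1}}'(x_k)^*\jmath_p(F_{i_{k+1}}(x_k)-y_{i_{k+1}})\big)$, $k=0,1,\dots$. *)

(* Defs.v *)
From HB Require Import structures.
From mathcomp Require Import all_boot all_order all_algebra.
From mathcomp Require Import all_classical all_reals all_analysis.

Set Implicit Arguments.
Unset Strict Implicit.
Unset Printing Implicit Defensive.

Import Order.TTheory GRing.Theory Num.Theory.
Import numFieldNormedType.Exports.

Local Open Scope classical_set_scope.
Local Open Scope ring_scope.

Section bounded_operators.
Context {R : realType} (V W : normedModType R).

Definition bounded_op_pred : {pred V -> W} :=
  mem [set f : V -> W | linear f /\ continuous f].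

Record bounded_op := BoundedOp {
  bounded_op_fun :> V -> W ;
  bounded_opP : bounded_op_fun \in bounded_op_pred }.

HB.instance Definition _ := [isSub for bounded_op_fun].
HB.instance Definition _ := [Choice of bounded_op by <:].

Lemma bounded_op_submod : submod_closed bounded_op_pred.
Proof.
split.
  rewrite inE; split; last exact: cst_continuous.
  by move=> a u v /=; rewrite scaler0 addr0.
move=> a f g; rewrite !inE => -[lf cf] [lg cg]; split.
  move=> b u v; rewrite !fctE lf lg !scalerDr !scalerA mulrC.
  by rewrite addrACA.
move=> x; apply: cvgD; last exact: cg.
by apply: cvgZr; exact: cf.
Qed.

HB.instance Definition _ :=
  GRing.isSubmodClosed.Build _ _ bounded_op_pred bounded_op_submod.
HB.instance Definition _ := [SubChoice_isSubLmodule of bounded_op by <:].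

Implicit Types f g : bounded_op.

Lemma bounded_op_linear f : linear f.
Proof. by have := bounded_opP f; rewrite inE => -[]. Qed.

Lemma bounded_op_continuous f : continuous f.
Proof. by have := bounded_opP f; rewrite inE => -[]. Qed.

HB.instance Definition _ f :=
  GRing.isLinear.Build R V W *:%R (bounded_op_fun f) (bounded_op_linear f).

Lemma bounded_opDE f g x : (f + g) x = f x + g x. Proof. by []. Qed.

Lemma bounded_opZE (a : R) f x : (a *: f) x = a *: f x. Proof. by []. Qed.

Definition op_norm f : R := sup [set `|f x| | x in [set x : V | `|x| <= 1]].

Lemma op_norm_has_sup f : has_sup [set `|f x| | x in [set x : V | `|x| <= 1]].
Proof.
split; first by exists `|f 0|, 0 => //=; rewrite normr0 ler01.
have /continuous_linear_bounded/bounded_funP/(_ 1)[M fM] :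
  {for 0, continuous f} by exact: bounded_op_continuous.
by exists M => _ [x x1 <-]; exact: fM.
Qed.

Lemma le_op_norm f x : `|f x| <= op_norm f * `|x|.
Proof.
have [->|x0] := eqVneq x 0; first by rewrite linear0 !normr0 mulr0.
rewrite -ler_pdivrMr ?normr_gt0//.
apply: ub_le_sup; first by case: (op_norm_has_sup f).
have xE : `|x|^-1 * `|x| = 1 by rewrite mulVf// normr_eq0.
exists (`|x|^-1 *: x); first by rewrite /= normrZ normfV normr_id xE.
by rewrite linearZ normrZ normfV normr_id mulrC.
Qed.

Lemma op_norm_le f (M : R) :
  (forall x, `|x| <= 1 -> `|f x| <= M) -> op_norm f <= M.
Proof.
move=> fM; apply: ge_sup; first by case: (op_norm_has_sup f).
by move=> _ [x x1 <-]; exact: fM.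
Qed.

Lemma op_norm_ge0 f : 0 <= op_norm f.
Proof.
apply: ub_le_sup; first by case: (op_norm_has_sup f).
by exists 0; rewrite /= ?normr0// linear0 normr0.
Qed.

Lemma op_normD f g : op_norm (f + g) <= op_norm f + op_norm g.
Proof.
apply: op_norm_le => x x1; rewrite bounded_opDE (le_trans (ler_normD _ _))//.
by apply: lerD; apply: (le_trans (le_op_norm _ _));
  rewrite ler_piMr// op_norm_ge0.
Qed.

Let op_normZ_le (a : R) f : op_norm (a *: f) <= `|a| * op_norm f.
Proof.
apply: op_norm_le => x x1; rewrite bounded_opZE normrZ ler_wpM2l//.
by apply: (le_trans (le_op_norm _ _)); rewrite ler_piMr// op_norm_ge0.
Qed.

Lemma op_normZ (a : R) f : op_norm (a *: f) = `|a| * op_norm f.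
Proof.
apply/le_anti; rewrite op_normZ_le/=.
have [->|a0] := eqVneq a 0; first by rewrite normr0 mul0r op_norm_ge0.
rewrite -ler_pdivlMl ?normr_gt0// -normfV.
by rewrite -{1}(scale1r f) -(mulVf a0) -scalerA.
Qed.

Lemma op_norm0_eq0 f : op_norm f = 0 -> f = 0.
Proof.
move=> f0; apply/val_inj/funext => x /=; apply/eqP.
by rewrite -normr_le0 (le_trans (le_op_norm _ _))// f0 mul0r.
Qed.

HB.instance Definition _ :=
  Lmodule_isNormed.Build R bounded_op op_normD op_normZ op_norm0_eq0.

End bounded_operators.

Definition dual {R : realType} (V : normedModType R) : normedModType R :=
  bounded_op V R^o.

Section bounded_op_comp.
Context {R : realType} (U V W : normedModType R).
Variables (g : bounded_op V W) (f : bounded_op U V).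

Lemma bounded_op_comp_subproof : g \o f \in @bounded_op_pred R U W.
Proof.
rewrite inE; split; first by move=> a u v /=; rewrite !linearP.
by move=> x; apply: continuous_comp; exact: bounded_op_continuous.
Qed.

Definition bounded_op_comp : bounded_op U W :=
  BoundedOp bounded_op_comp_subproof.

End bounded_op_comp.

Definition adjoint {R : realType} (V W : normedModType R)
    (A : bounded_op V W) (g : dual W) : dual V :=
  bounded_op_comp g A.

Section bidual.
Context {R : realType} (V : normedModType R).

Section evaluation.
Variable x : V.

Lemma bidual_embed_subproof :
  (fun f : dual V => f x : R^o) \in @bounded_op_pred R (dual V) R^o.
Proof.
rewrite inE; have lin : linear (fun f : dual V => f x : R^o) by [].
split=> //.
pose L := GRing.isLinear.Build _ _ _ _ (fun f : dual V => f x : R^o) lin.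
pose g : {linear dual V -> R^o} := HB.pack (fun f : dual V => f x : R^o) L.
apply: (@bounded_linear_continuous _ _ _ g); apply/bounded_funP => r.
exists (r * `|x|) => f fr; apply: (le_trans (le_op_norm f x)).
by rewrite ler_wpM2r.
Qed.

Definition bidual_embed : dual (dual V) := BoundedOp bidual_embed_subproof.

End evaluation.

(* The identification of the bidual with [V]: the inverse of the canonical
   embedding, meaningful when [V] is reflexive. *)
Definition of_bidual (u : dual (dual V)) : V :=
  xget 0 [set x | bidual_embed x = u].

End bidual.

(* [hs] is not used in the carrier, but determines the norm. *)
Definition lsprod {R : realType} (s : R) (hs : 1 <= s) (N : nat)
  (Y : 'I_N -> normedModType R) : Type := forall i, Y i.

Section lsprod_normed.
Context {R : realType} (s : R) (hs : 1 <= s) (N : nat).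
Variable Y : 'I_N -> normedModType R.

Local Notation lsprod := (lsprod hs Y).

HB.instance Definition _ := gen_eqMixin lsprod.
HB.instance Definition _ := gen_choiceMixin lsprod.

Implicit Types y z : lsprod.

Let add y z : lsprod := fun i => y i + z i.
Let opp y : lsprod := fun i => - y i.
Let zero : lsprod := fun i => 0.
Let scale (a : R) y : lsprod := fun i => a *: y i.

Let addA : associative add.
Proof. by move=> x y z; apply: functional_extensionality_dep => i; exact: addrA. Qed.
Let addC : commutative add.
Proof. by move=> x y; apply: functional_extensionality_dep => i; exact: addrC. Qed.
Let add0 : left_id zero add.
Proof. by move=> x; apply: functional_extensionality_dep => i; exact: add0r. Qed.
Let addN : left_inverse zero opp add.
Proof. by move=> x; apply: functional_extensionality_dep => i; exact: addNr. Qed.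

HB.instance Definition _ := GRing.isZmodule.Build lsprod addA addC add0 addN.

Let scaleA a b y : scale a (scale b y) = scale (a * b) y.
Proof. by apply: functional_extensionality_dep => i; exact: scalerA. Qed.
Let scale1 : left_id 1 scale.
Proof. by move=> y; apply: functional_extensionality_dep => i; exact: scale1r. Qed.
Let scaleDr : right_distributive scale +%R.
Proof. by move=> a y z; apply: functional_extensionality_dep => i; exact: scalerDr. Qed.
Let scaleDl y : {morph scale^~ y : a b / a + b}.
Proof. by move=> a b; apply: functional_extensionality_dep => i; exact: scalerDl. Qed.

HB.instance Definition _ :=
  GRing.Zmodule_isLmodule.Build R lsprod scaleA scale1 scaleDr scaleDl.

Definition ls_norm y : R := (\sum_(i < N) `|y i| `^ s) `^ s^-1.

Let s_gt0 : 0 < s. Proof. exact: lt_le_trans hs. Qed.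
Let s_ge0 : 0 <= s. Proof. exact: ltW. Qed.
Let sum_ge0 (a : 'I_N -> R) : 0 <= \sum_(i < N) a i `^ s.
Proof. by apply: sumr_ge0 => i _; exact: powR_ge0. Qed.

Let ls_normX y : ls_norm y `^ s = \sum_(i < N) `|y i| `^ s.
Proof. by rewrite /ls_norm -powRrM mulVf ?gt_eqF// powRr1. Qed.

Let ls_norm_le y (M : R) :
  0 <= M -> \sum_(i < N) `|y i| `^ s <= M `^ s -> ls_norm y <= M.
Proof.
move=> M0 /(ge0_ler_powR (ltW (_ : 0 < s^-1))).
rewrite invr_gt0 => /(_ s_gt0); rewrite !nnegrE => /(_ (sum_ge0 _) (powR_ge0 _ _)).
by rewrite -(powRrM M) mulfV ?gt_eqF// (powRr1 M0).
Qed.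

Lemma ls_norm0_eq0 y : ls_norm y = 0 -> y = 0.
Proof.
move=> y0; have := ls_normX y; rewrite y0 powR0 ?gt_eqF// => /esym/eqP.
rewrite psumr_eq0; last by move=> i _; exact: powR_ge0.
move=> /allP h; apply: functional_extensionality_dep => i.
have := h i (mem_index_enum i); rewrite /= powR_eq0 normr_eq0.
by move=> /andP[/eqP].
Qed.

Lemma ls_normZ (a : R) y : ls_norm (a *: y) = `|a| * ls_norm y.
Proof.
rewrite /ls_norm.
under eq_bigr do rewrite normrZ powRM//.
rewrite -mulr_sumr powRM ?powR_ge0//.
by rewrite -powRrM mulfV ?gt_eqF// powRr1.
Qed.

Let ls_normD_unit (a b : R) y z : 0 < a -> 0 < b -> ls_norm y = a ->
  ls_norm z = b -> ls_norm (y + z) <= a + b.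
Proof.
move=> a0 b0 ya zb; have ab0 : 0 < a + b by rewrite addr_gt0.
apply: ls_norm_le; first exact: ltW.
have ab1 : b / (a + b) = 1 - a / (a + b).
  by rewrite -[X in X - _](mulfV (lt0r_neq0 ab0)) -mulrBl addrAC subrr add0r.
have t01 : 0 <= a / (a + b) /\ a / (a + b) <= 1.
  split; first by rewrite divr_ge0// ltW.
  by rewrite ler_pdivrMr// mul1r lerDl ltW.
have key i : `|(y + z) i| `^ s <=
    (a + b) `^ s * (a / (a + b) * (`|y i| `^ s / a `^ s)
                    + b / (a + b) * (`|z i| `^ s / b `^ s)).
  have powV (c d : R) : 0 < d -> 0 <= c -> c `^ s / d `^ s = (c / d) `^ s.
    move=> d0 c0; rewrite powRM// ?invr_ge0 ?ltW//; congr (_ * _).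
    by rewrite -!powR_inv1 ?powR_ge0 ?ltW// -!powRrM mulrC.
  rewrite !powV// -ler_pdivrMl ?powR_gt0// mulrC powV//.
  have [t0 t1] := t01.
  rewrite ab1.
  have cvx := @convex_powR R s hs (Itv01 t0 t1) (`|y i| / a) (`|z i| / b).
  apply: (@le_trans _ _ ((a / (a + b) * (`|y i| / a) +
                          (1 - a / (a + b)) * (`|z i| / b)) `^ s)); last first.
    by apply: cvx; rewrite inE/= in_itv/= andbT divr_ge0// ltW.
  apply: ge0_ler_powR => //; rewrite ?nnegrE ?divr_ge0// ?(ltW ab0)//.
    by rewrite -ab1 addr_ge0// mulr_ge0// divr_ge0// ltW.
  rewrite -ab1 [X in _ <= X](_ : _ = (`|y i| + `|z i|) / (a + b)).
    by rewrite ler_pM2r ?invr_gt0// ler_normD.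
  by rewrite mulrDl; congr (_ + _); rewrite mulrAC mulrCA mulfV ?gt_eqF// mulr1 mulrC.
apply: (le_trans (ler_sum _ (fun i _ => key i))).
rewrite -mulr_sumr ler_piMr ?powR_ge0// big_split/= -!mulr_sumr -!mulr_suml.
rewrite -!ls_normX ya zb !mulfV ?gt_eqF ?powR_gt0// !mulr1 ab1.
by rewrite addrC subrK.
Qed.

Lemma ls_normD y z : ls_norm (y + z) <= ls_norm y + ls_norm z.
Proof.
have n0 w : 0 <= ls_norm w by exact: powR_ge0.
have [/ls_norm0_eq0 ->|y0] := eqVneq (ls_norm y) 0.
  by rewrite add0r lerDr.
have [/ls_norm0_eq0 ->|z0] := eqVneq (ls_norm z) 0.
  by rewrite addr0 lerDl.
by apply: ls_normD_unit => //; rewrite lt_neqAle eq_sym ?y0 ?z0 n0.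
Qed.

HB.instance Definition _ :=
  Lmodule_isNormed.Build R lsprod ls_normD ls_normZ ls_norm0_eq0.

End lsprod_normed.

(* The initial topology for the evaluation map into [R^(dual V)], i.e. the
   coarsest topology making all bounded linear functionals continuous. *)
Definition weak {R : realType} (V : normedModType R) : topologicalType :=
  initial_topology
    (fun (x : V) => (fun f : dual V => f x) : prod_topology (fun _ => R)).

Section geometry.
Context {R : realType} (V : normedModType R).

(* With values in [\bar R], so that the infimum over the empty set (when [V]
   is the zero space) is [+oo]. *)
Definition convexity_modulus (tau : R) : \bar R :=
  ereal_inf [set ((1 - 2^-1 * `|u.1 + u.2|)%:E) |
    u in [set u : V * V | [/\ `|u.1| = 1, `|u.2| = 1 & tau <= `|u.1 - u.2|]]].

Definition p_convex (p : R) : Prop :=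
  exists2 K : R, 0 < K &
    forall tau : R, 0 < tau <= 2 -> ((K * tau `^ p)%:E <= convexity_modulus tau)%E.

Definition smoothness_modulus (tau : R) : R :=
  sup [set 2^-1 * (`|u.1 + tau *: u.2| + `|u.1 - tau *: u.2|) - 1 |
    u in [set u : V * V | `|u.1| = 1 /\ `|u.2| = 1]].

Definition uniformly_smooth : Prop :=
  smoothness_modulus tau / tau @[tau --> 0^'+] --> (0 : R).

Definition duality_map (p : R) (x : V) : set (dual V) :=
  [set f : dual V | f x = `|x| * `|f| /\ `|f| = `|x| `^ (p - 1)].

(* The duality map as a function, meaningful when it is single-valued. *)
Definition J (p : R) (x : V) : dual V := xget 0 (duality_map p x).

(* [q] is meant to be the conjugate exponent of [p]. *)
Definition bregman (p q : R) (z w : V) : R :=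
  q^-1 * `|z| `^ p + p^-1 * `|w| `^ p - J p z w.

Definition bregman_ball (p q nu : R) (x : V) : set V :=
  [set z | bregman p q z x <= nu].

End geometry.

(* Fréchet differentiability of a map with domain [D], relative to [D]: no
   neighbourhood of [x] is required to lie in [D]. *)
Definition frechet_derivative {R : realType} (V W : normedModType R)
    (D : set V) (f : V -> W) (x : V) (A : bounded_op V W) : Prop :=
  `|f z - f x - A (z - x)| / `|z - x| @[z --> within D x^'] --> (0 : R).

Section problem.
Context {R : realType} (s : R) (hs : 1 <= s) (N : nat).
Context (V : normedModType R) (Y : 'I_N -> normedModType R).

Definition stack (F : forall i, V -> Y i) (x : V) : lsprod hs Y :=
  fun i => F i x.

Definition solutions (F : forall i, V -> Y i) (y : lsprod hs Y) (S : set V) :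
    set V :=
  [set x | stack F x = y /\ S x].

Definition minimum_distance_solution (p q : R) (F : forall i, V -> Y i)
    (y : lsprod hs Y) (S : set V) (x0 xdag : V) : Prop :=
  solutions F y S xdag /\
  bregman p q x0 xdag = inf [set bregman p q x0 x | x in solutions F y S].

(* [mu k.+1] and [idx k.+1] are the step size and the index used to compute
   the iterate [k.+1]. *)
Fixpoint sgd (p q : R) (F : forall i, V -> Y i)
    (dF : forall i, V -> bounded_op V (Y i)) (y : lsprod hs Y)
    (jp : forall i, Y i -> dual (Y i)) (mu : nat -> R) (x0 : V)
    (idx : nat -> 'I_N) (k : nat) : V :=
  if k is k'.+1 then
    let x := sgd p q F dF y jp mu x0 idx k' in
    let i := idx k in
    of_bidual (J q (J p x - mu k *: adjoint (dF i x) (jp i (F i x - y i))))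
  else x0.

End problem.

Section iid.
Context d (T : measurableType d) (R : realType) (P : probability T R).
Context (E : finType).

Definition mutually_independent (X : nat -> T -> E) : Prop :=
  forall (I : seq nat) (A : nat -> set E), uniq I ->
    (P (\bigcap_(j in [set` I]) (X j @^-1` A j)) =
     \prod_(j <- I) P (X j @^-1` A j))%E.

Definition iid_uniform (X : nat -> T -> E) : Prop :=
  [/\ forall j (A : set E), measurable (X j @^-1` A),
      forall j (a : E), P (X j @^-1` [set a]) = (#|E|%:R^-1)%:E &
      mutually_independent X].

End iid.

(* Main.v *)
Require Import Defs.
From HB Require Import structures.
From mathcomp Require Import all_boot all_order all_algebra.
From mathcomp Require Import all_classical all_reals all_analysis.
From mathcomp Require Import measurable_realfun.
From mathcomp Require Import ring lra.

Import Order.TTheory GRing.Theory Num.Theory.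
Import numFieldNormedType.Exports.

Local Open Scope classical_set_scope.
Local Open Scope ring_scope.

(** The Bregman distance [B_k] from the iterate [x_k] to the solution [xdag]
    never increases, whatever indices are drawn ([bregman_descent]): one step
    with index [i] lowers it by at least [C mu_k |F_i x_k - y_i|^p]. So along
    every path the iterates stay in the ball where the assumptions hold, and
    it is enough to show that [B_k] tends to 0 along almost every path;
    bounded convergence then gives the three limits.

    Averaging the descent over the next index, which is independent of [x_k],
    replaces the residual of the drawn index by the residuals of all indices.
    Hence the costs [mu_k (max_i |F_i x_k - y_i|)^p] have a summable mean and
    are summable along almost every path ([mean_summable_ae]).

    The rest is deterministic ([bregman_orbit_cvg]). As the step sizes are not
    summable, the residual vanishes at some iterate, which is then a solution,
    or it has arbitrarily small record values. Up to a
    record index [l] no residual is smaller than the one of [x_l], so by the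
    tangential cone condition [J x_l - J x_m] paired with [x_l - xdag] is at
    most a multiple of the costs between [m] and [l] ([orbit_pairing]).
    With the three-point identity this makes the iterates of record index a
    Cauchy sequence. Its limit [z] solves the problem. The null space condition
    keeps [J x_k - J x_0] orthogonal to [z - xdag], and [xdag] is the solution
    nearest to [x_0], so [B_k] is at most the Bregman distance from [x_k] to
    [z] ([bregman_orbit_le_solution]). That distance tends to 0 along the
    records, and [B_k] is monotone.

    The geometry of the space enters through four facts. Uniform smoothness
    gives norming functionals ([norming_functional]) and makes them depend
    continuously on the point ([norming_functional_close]), so that the duality
    map is a continuous function. Convexity makes functionals attain their norm
    ([p_convex_norm_attained]), so that the duality map is onto and a step of
    the method is an exact additive step in the dual ([J_of_bidual]). Finally
    the smoothness inequality assumed on the dual turns, by conjugation, into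
    the lower bound [bregman_ge] of the Bregman distance by a power of the
    norm. *)

(** * Bounded functionals and uniform smoothness *)

Section dual_norm.
Context {R : realType} {V : normedModType R}.
Implicit Types (f g : dual V) (x h : V).

Lemma dualBE f g x : (f - g) x = f x - g x. Proof. by []. Qed.

Lemma dualZE (a : R) f x : (a *: f) x = a * f x. Proof. by []. Qed.

Lemma dual_le f x : f x <= `|f| * `|x|.
Proof. exact: le_trans (ler_norm _) (le_op_norm f x). Qed.

Lemma dual_norm_le f (M : R) :
  (forall h, `|h| <= 1 -> f h <= M) -> `|f| <= M.
Proof.
move=> fM; apply: op_norm_le => h h1; rewrite ler_norml fM// andbT.
by rewrite lerNl -linearN/= fM// normrN.
Qed.

Lemma dual_le1 f x : `|f| <= 1 -> f x <= `|x|.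
Proof. by move=> f1; rewrite (le_trans (dual_le f x))// ler_piMl. Qed.

Lemma bounded_functional (phi : V -> R) (M : R) :
  (forall a u v, phi (a *: u + v) = a * phi u + phi v) ->
  (forall h, `|phi h| <= M * `|h|) ->
  exists f, forall h, f h = phi h.
Proof.
move=> lin bnd; have phiP : phi \in @bounded_op_pred R V R^o.
  rewrite inE; have linphi : linear (phi : V -> R^o) by move=> a u v; exact: lin.
  split=> //.
  pose L := GRing.isLinear.Build _ _ _ _ (phi : V -> R^o) linphi.
  pose g : {linear V -> R^o} := HB.pack (phi : V -> R^o) L.
  apply: (@bounded_linear_continuous _ _ _ g); apply/bounded_funP => r.
  exists (`|M| * r) => h hr; apply: (le_trans (bnd h)).
  apply: (@le_trans _ _ (`|M| * `|h|)); first by rewrite ler_wpM2r// ler_norm.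
  by rewrite ler_wpM2l.
by exists (BoundedOp phiP).
Qed.

End dual_norm.

Section uniform_smoothness.
Context {R : realType} {V : normedModType R}.
Hypothesis V_smooth : uniformly_smooth V.
Implicit Types (f g : dual V) (x z h : V).

(** The definition, made homogeneous: the direction and the base point are
    no longer normalised, which is the form in which smoothness is used. *)
Lemma uniformly_smooth_le (eps : R) : 0 < eps -> exists2 delta : R, 0 < delta &
  forall x h, `|h| <= delta * `|x| ->
    `|x + h| + `|x - h| <= 2 * `|x| + eps * `|h|.
Proof.
move=> eps0; have e2 : 0 < eps / 2 by rewrite divr_gt0.
move/cvgrPdist_le : V_smooth => /(_ _ e2); rewrite near_withinE => -[d /= d0 dP].
exists (d / 2); first by rewrite divr_gt0.
move=> x h hx.
have [->|h0] := eqVneq h 0.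
  by rewrite addr0 subr0 normr0 mulr0 addr0 mulr_natl mulr2n.
have hgt : 0 < `|h| by rewrite normr_gt0.
have x0 : x != 0.
  by apply: contra_neq h0 => x0; apply/normr0_eq0/le_anti;
    rewrite normr_ge0 (le_trans hx)// x0 normr0 mulr0.
have xgt : 0 < `|x| by rewrite normr_gt0.
pose tau := `|h| / `|x|.
have tau0 : 0 < tau by rewrite divr_gt0.
have taud : tau <= d / 2 by rewrite ler_pdivrMr.
have := dP tau; rewrite /ball /= sub0r normrN gtr0_norm//.
have dd : d / 2 < d by lra.
move=> /(_ (le_lt_trans taud dd) tau0).
rewrite sub0r normrN => /(le_trans (ler_norm _)); rewrite ler_pdivrMr// => rho.
have : 2^-1 * (`| `|x|^-1 *: x + tau *: (`|h|^-1 *: h)| +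
    `| `|x|^-1 *: x - tau *: (`|h|^-1 *: h)|) - 1 <= eps / 2 * tau.
  apply: (le_trans _ rho); apply: ub_le_sup.
    exists tau => _ [[u v]/= [u1 v1] <-].
    have := ler_normD u (tau *: v); have := ler_normB u (tau *: v).
    by rewrite normrZ u1 v1 gtr0_norm// mulr1; lra.
  exists (`|x|^-1 *: x, `|h|^-1 *: h); last by [].
  by rewrite /= !normrZ !normfV !normr_id !mulVf ?gt_eqF.
rewrite scalerA /tau mulrAC divff ?gt_eqF// mul1r -scalerDr -scalerBr !normrZ.
rewrite normfV normr_id -mulrDr; set s : R := `|x + h| + _ => H.
have {}H : `|x| * (2^-1 * (`|x|^-1 * s) - 1) <= `|x| * (eps / 2 * (`|h| / `|x|)).
  by rewrite ler_pM2l.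
have e1 : `|x| * (2^-1 * (`|x|^-1 * s) - 1) = s / 2 - `|x|.
  by field; rewrite gt_eqF.
have e2' : `|x| * (eps / 2 * (`|h| / `|x|)) = eps * `|h| / 2.
  by field; rewrite gt_eqF.
by move: H; rewrite e1 e2'; lra.
Qed.

(** The one-sided directional derivative [D] of the norm at [x] is sublinear
    because the norm is convex. Uniform smoothness gives [D h + D (- h) <= 0],
    so [D] is linear. *)
Lemma norming_functional x : exists2 f : dual V, `|f| <= 1 & f x = `|x|.
Proof.
have [->|x0] := eqVneq x 0.
  by exists 0; rewrite ?normr0// linear0.
have xgt : 0 < `|x| by rewrite normr_gt0.
pose dq h (t : R) : R := (`|x + t *: h| - `|x|) / t.
pose D h : R := inf [set dq h t | t in [set t : R | (0 : R) < t]].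
have dq_lb h t : 0 < t -> - `|h| <= dq h t.
  move=> t0; rewrite ler_pdivlMr// mulNr lerBrDr.
  have := ler_normB (x + t *: h) (t *: h); rewrite addrK normrZ gtr0_norm//.
  by rewrite mulrC; lra.
have dq_le h t : 0 < t -> dq h t <= `|h|.
  move=> t0; rewrite ler_pdivrMr// lerBlDr.
  by have := ler_normD x (t *: h); rewrite normrZ gtr0_norm//; lra.
have hlb h : has_lbound [set dq h t | t in [set t : R | (0 : R) < t]].
  by exists (- `|h|); move=> _ [t t0 <-]; exact: dq_lb.
have hinf h : has_inf [set dq h t | t in [set t : R | (0 : R) < t]].
  by split; [exists (dq h 1), 1; rewrite /=|exact: hlb].
have D_le h t : 0 < t -> D h <= dq h t.
  by move=> t0; apply: ge_inf => //; exists t.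
have D_ge h M : (forall t, 0 < t -> M <= dq h t) -> M <= D h.
  move=> hM; apply: lb_le_inf; first by exists (dq h 1), 1; rewrite /=.
  by move=> _ [t t0 <-]; exact: hM.
(* Slopes of a convex function increase. *)
have dq_mono h t s : 0 < t -> t <= s -> dq h t <= dq h s.
  move=> t0 ts; have s0 : 0 < s by exact: lt_le_trans ts.
  rewrite ler_pdivrMr//.
  have : `|s *: (x + t *: h)| <= t * `|x + s *: h| + (s - t) * `|x|.
    have -> : s *: (x + t *: h) = t *: (x + s *: h) + (s - t) *: x.
      rewrite !scalerDr scalerBl !scalerA (mulrC s t).
      by rewrite [RHS]addrC [RHS]addrA subrK.
    apply: (le_trans (ler_normD _ _)).
    by rewrite !normrZ (gtr0_norm t0) (@ger0_norm _ (s - t))// subr_ge0.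
  rewrite normrZ gtr0_norm// => H.
  rewrite -(ler_pM2l s0) /dq.
  have -> : s * ((`|x + s *: h| - `|x|) / s * t) = (`|x + s *: h| - `|x|) * t.
    by field; rewrite gt_eqF.
  by move: H; lra.
have D_sub h k : D (h + k) <= D h + D k.
  rewrite -lerBlDr; apply: (D_ge h) => t t0; rewrite lerBlDr -lerBlDl.
  apply: D_ge => s s0; rewrite lerBlDl.
  pose m := Num.min t s; have m0 : 0 < m by rewrite lt_min t0.
  apply: (@le_trans _ _ (dq h m + dq k m)); last first.
    by rewrite lerD// dq_mono// ge_min lexx ?orbT.
  have m20 : 0 < m / 2 by rewrite divr_gt0.
  apply: (le_trans (D_le _ _ m20)).
  rewrite /dq -mulrDl ler_pdivrMr//.
  have : `|2 *: (x + (m / 2) *: (h + k))| <= `|x + m *: h| + `|x + m *: k|.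
    have -> : 2 *: (x + (m / 2) *: (h + k)) = (x + m *: h) + (x + m *: k).
      by rewrite scalerDr scalerA mulrC divfK// scalerDr scaler_nat mulr2n addrACA.
    exact: ler_normD.
  rewrite normrZ ger0_norm// => H.
  set a := `|_ + m *: h| in H *; set b := `|_ + m *: k| in H *.
  have -> : (a - `|x| + (b - `|x|)) / m * (m / 2) = (a + b) / 2 - `|x|.
    by field; rewrite gt_eqF.
  by move: H; lra.
have D_opp_le h : D h + D (- h) <= 0.
  apply/ler_addgt0Pr => e e0; rewrite add0r.
  have [|d d0 dP] := @uniformly_smooth_le (e / (`|h| + 1)).
    by rewrite divr_gt0// ltr_wpDl.
  have [t t0 tP] : exists2 t : R, 0 < t & `|t *: h| <= d * `|x|.
    exists (d * `|x| / (`|h| + 1)); first by rewrite divr_gt0 ?mulr_gt0// ltr_wpDl.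
    rewrite normrZ gtr0_norm ?divr_gt0 ?mulr_gt0 ?ltr_wpDl//.
    by rewrite mulrAC ler_pdivrMr ?ltr_wpDl// ler_wpM2l ?mulr_ge0 ?ltW// ltrDl.
  apply: (le_trans (lerD (D_le _ _ t0) (D_le _ _ t0))).
  rewrite /dq -mulrDl ler_pdivrMr// scalerN.
  have := dP _ _ tP; rewrite normrZ (gtr0_norm t0).
  have : e / (`|h| + 1) * (t * `|h|) <= e * t.
    rewrite mulrAC ler_pdivrMr ?ltr_wpDl// -!mulrA ler_wpM2l ?ltW//.
    by rewrite ltr_pM2l// ltrDl.
  by lra.
have D0 : D 0 = 0.
  apply/le_anti/andP; split.
    by apply: (le_trans (D_le _ _ ltr01)); rewrite /dq scaler0 addr0 subrr mul0r.
  by apply: D_ge => t _; rewrite /dq scaler0 addr0 subrr mul0r.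
have D_opp h : D (- h) = - D h.
  apply/le_anti/andP; split; first by have := D_opp_le h; lra.
  by have := D_sub h (- h); rewrite subrr D0; lra.
have D_add h k : D (h + k) = D h + D k.
  apply/le_anti/andP; split; first exact: D_sub.
  by have := D_sub (h + k) (- k); rewrite addrK D_opp; lra.
have D_pos a h : 0 < a -> D (a *: h) = a * D h.
  have le b k : 0 < b -> D (b *: k) <= b * D k.
    move=> b0; rewrite mulrC -ler_pdivrMr//; apply: D_ge => t t0.
    rewrite ler_pdivrMr//; have tb : 0 < t / b by rewrite divr_gt0.
    apply: (le_trans (D_le _ _ tb)); rewrite /dq scalerA divfK ?gt_eqF//.
    by rewrite invf_div mulrA mulrAC.
  move=> a0; apply/le_anti; rewrite le//= mulrC -ler_pdivlMr// mulrC.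
  have ai : 0 < a^-1 by rewrite invr_gt0.
  by have := le _ (a *: h) ai; rewrite scalerA mulVf ?gt_eqF// scale1r.
have D_scale a h : D (a *: h) = a * D h.
  have [a0|a0|->] := ltgtP a 0; last 2 first.
  - exact: D_pos.
  - by rewrite scale0r mul0r.
  - by rewrite -[a *: h]opprK -scaleNr D_opp D_pos ?oppr_gt0// mulNr opprK.
have D_norm h : D h <= `|h| by exact: le_trans (D_le _ _ ltr01) (dq_le _ _ ltr01).
have [|h|f fD] := @bounded_functional _ V D 1.
- by move=> a u v; rewrite D_add D_scale.
- rewrite mul1r ler_norml D_norm andbT lerNl -D_opp.
  by rewrite (le_trans (D_norm _))// normrN.
exists f; first by apply: dual_norm_le => h h1; rewrite fD (le_trans (D_norm h)).
rewrite fD; apply/le_anti; rewrite D_norm/=; apply: D_ge => t t0.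
rewrite /dq -[X in `|X + _|]scale1r -scalerDl normrZ gtr0_norm ?addr_gt0//.
by rewrite -[X in _ - X]mul1r -mulrBl addrAC subrr add0r mulrAC divff ?mul1r//
  gt_eqF.
Qed.

(** Test the two functionals on [z + k] and [z - k], with [k] of norm about
    [delta |z|]: smoothness bounds the sum of these norms by [2 |z|] up to
    a small multiple of [|k|], which leaves little room for [(g - f) k]. *)
Lemma norming_functional_close (eps : R) : 0 < eps ->
  exists2 delta : R, 0 < delta & forall x z f g,
    `|f| <= 1 -> f x = `|x| -> `|g| <= 1 -> g z = `|z| ->
    z != 0 -> `|x - z| <= delta * `|z| -> `|f - g| <= eps.
Proof.
move=> eps0; have [|d d0 dP] := @uniformly_smooth_le (eps / 2).
  by rewrite divr_gt0.
exists (eps * d / 4); first by rewrite divr_gt0// mulr_gt0.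
move=> x z f g f1 fx g1 gz z0 xz; have zgt : 0 < `|z| by rewrite normr_gt0.
rewrite distrC; apply: dual_norm_le => h h1.
have dz : 0 < d * `|z| by rewrite mulr_gt0.
set k := (d * `|z|) *: h.
have kd : `|k| <= d * `|z|.
  by rewrite normrZ gtr0_norm// ler_piMr// ltW.
have := dP _ _ kd; have := dual_le1 _ (z + k) g1; have := dual_le1 _ (z - k) f1.
have : f (x - z) <= `|x - z| by exact: dual_le1.
rewrite !linearB !linearD/= gz fx -/(_ - _).
have -> : g k = d * `|z| * g h by rewrite linearZ.
have -> : f k = d * `|z| * f h by rewrite linearZ.
have := ler_normB x (x - z); rewrite subKr.
have : eps / 2 * `|k| <= eps / 2 * (d * `|z|).
  by rewrite ler_wpM2l// divr_ge0// ltW.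
move: xz; set w := d * `|z|.
have -> : eps * d / 4 * `|z| = eps * w / 4 by rewrite /w; ring.
move=> *; have : w * (g h - f h) <= w * eps by lra.
by rewrite ler_pM2l.
Qed.

End uniform_smoothness.

(** * Norm attainment and the duality map *)

Section norm_attainment.
Context {R : realType} {X : completeNormedModType R}.

Lemma cauchy_seq_cvg (u : nat -> X) :
  (forall e : R, 0 < e ->
    exists M, forall m n, (M <= m)%N -> (M <= n)%N -> `|u m - u n| <= e) ->
  exists l : X, u @ \oo --> l.
Proof.
move=> u_cauchy; suff : cvg (u @ \oo) by move=> cu; exists (lim (u @ \oo)).
apply/cauchy_cvgP/cauchy_exP => e e0.
have [|M MP] := u_cauchy (e / 2); first by rewrite divr_gt0.
exists (u M), M => // n /= Mn; rewrite -ball_normE/=.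
by rewrite (le_lt_trans (MP _ _ (leqnn M) Mn))// gtr_pMr// invf_lt1// ltr1n.
Qed.

(** Take unit vectors [u n] on which [f] is nearly [|f|]. Then
    [f (u m + u n)] is nearly [2 |f|], so the midpoints of [u m] and [u n]
    are nearly unit vectors, and convexity forces [u] to be Cauchy. *)
Lemma p_convex_norm_attained {p : R} (f : dual X) :
  p_convex X p -> exists2 x : X, `|x| <= 1 & f x = `|f|.
Proof.
move=> -[K K0 Kcvx].
have [->|f0] := eqVneq f 0.
  by exists 0; rewrite ?normr0// linear0.
have fgt : 0 < `|f| by rewrite normr_gt0.
have /choice[u uP] : forall n : nat, exists x : X,
    `|x| = 1 /\ `|f| - `|f| / n.+1%:R < f x.
  move=> n; have e0 : 0 < `|f| / n.+2%:R by rewrite divr_gt0.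
  have [_ [x /= x1 <-] fx] := sup_adherent e0 (op_norm_has_sup f).
  have {}fx : `|f| - `|f| / n.+2%:R < `|f x| := fx.
  have efx : `|f| / n.+2%:R <= `|f| / n.+1%:R.
    by rewrite ler_pM2l// lef_pV2 ?posrE// ler_nat.
  have fx0 : 0 < `|f x|.
    by rewrite (le_lt_trans _ fx)// subr_ge0 ler_piMr ?invf_le1 ?ler1n.
  have x0 : x != 0 by apply: contraTneq fx0 => ->; rewrite linear0 normr0 ltxx.
  have xgt : 0 < `|x| by rewrite normr_gt0.
  exists ((Num.sg (f x) / `|x|) *: x); split.
    rewrite normrZ normrM normfV normr_id normr_sg -normr_gt0 fx0 mul1r mulVf//.
    by rewrite gt_eqF.
  have -> : f ((Num.sg (f x) / `|x|) *: x) = Num.sg (f x) / `|x| * f x.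
    by rewrite linearZ.
  have -> : Num.sg (f x) / `|x| * f x = `|f x| / `|x|.
    by rewrite mulrAC normrEsg.
  apply: (@lt_le_trans _ _ `|f x|); last first.
    by rewrite ler_pdivlMr// ler_piMr.
  by apply: le_lt_trans fx; rewrite lerD2l lerN2.
have [l ul] : exists l : X, u @ \oo --> l.
  apply: cauchy_seq_cvg => e e0; pose tau := Num.min e 2.
  have tau0 : 0 < tau by rewrite lt_min e0 ltr0n.
  have Kt0 : 0 < K * tau `^ p by rewrite mulr_gt0// powR_gt0.
  have [M MP] : exists M : nat, (K * tau `^ p)^-1 < M.+1%:R.
    by exists (Num.truncn (K * tau `^ p)^-1); exact: truncnS_gt.
  exists M => m n Mm Mn; rewrite leNgt; apply/negP => emn.
  have t2 : 0 < tau <= 2 by rewrite tau0 ge_min lexx orbT.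
  have := Kcvx tau t2; rewrite leNgt => /negP; apply.
  apply: (@le_lt_trans _ _ (1 - 2^-1 * `|u m + u n|)%:E).
    apply: ereal_inf_lbound; exists (u m, u n) => //=; split.
    - by case: (uP m).
    - by case: (uP n).
    - by rewrite ge_min (ltW emn).
  rewrite lte_fin.
  have [_ um] := uP m; have [_ un] := uP n.
  have inv_le k : (M <= k)%N -> `|f| / k.+1%:R <= `|f| / M.+1%:R.
    by move=> Mk; rewrite ler_pM2l// lef_pV2 ?posrE// ler_nat.
  have := dual_le f (u m + u n); rewrite linearD/= => fmn.
  have MK : M.+1%:R^-1 < K * tau `^ p.
    by rewrite -[ltRHS]invrK ltf_pV2 ?posrE ?invr_gt0.
  apply: lt_trans MK; rewrite ltrBlDr -ltrBlDl.
  have H : `|f| * (2 - 2 * M.+1%:R^-1) < `|f| * `|u m + u n|.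
    have := inv_le _ Mm; have := inv_le _ Mn; move: um un fmn.
    rewrite mulrBr mulrCA; set a := `|f| / m.+1%:R; set b := `|f| / n.+1%:R.
    by set c := `|f| / M.+1%:R; set g := `|f| * `|_|; lra.
  by move: H; rewrite ltr_pM2l//; set c := M.+1%:R^-1; lra.
have l1 : `|l| <= 1.
  by apply: (cvgr_to_le (cvg_norm ul)); apply: nearW => n; case: (uP n) => ->.
exists l => //; apply/le_anti/andP; split.
  by rewrite (le_trans (dual_le f l))// ler_piMr.
have fl : f (u n) @[n --> \oo] --> f l.
  by apply: continuous_cvg => //; exact: bounded_op_continuous.
apply/ler_addgt0Pr => e e0.
move/cvgrPdist_le : fl => /(_ (e / 2)); rewrite divr_gt0// => /(_ isT)[M _ MP].
have [k kP] : exists k : nat, `|f| / (e / 2) < k.+1%:R.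
  by exists (Num.truncn (`|f| / (e / 2))); exact: truncnS_gt.
have := MP (maxn M k) (leq_maxl _ _) => /=.
rewrite distrC => /(le_trans (ler_norm _)).
have [_] := uP (maxn M k).
have : `|f| / (maxn M k).+1%:R <= e / 2.
  rewrite ler_pdivrMr// mulrC -ler_pdivrMr ?divr_gt0// (le_trans (ltW kP))//.
  by rewrite ler_nat ltnS leq_maxr.
by set b := `|f| / _.+1%:R; lra.
Qed.

End norm_attainment.

Section duality.
Context {R : realType} {p q : R}.
Hypotheses (p_gt1 : 1 < p) (pq_conj : p^-1 + q^-1 = 1).

Lemma conjugate_gt1 : 1 < q.
Proof.
have p0 : 0 < p by rewrite (lt_trans _ p_gt1).
have : 0 < q^-1 < 1.
  have : 0 < p^-1 < 1 by rewrite invr_gt0 p0 invf_lt1.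
  by move: pq_conj; lra.
by rewrite invr_gt0 => /andP[q0]; rewrite invf_lt1.
Qed.

Lemma conjugateM : (p - 1) * (q - 1) = 1.
Proof.
have p0 : p != 0 by rewrite gt_eqF// (lt_trans _ p_gt1).
have q0 : q != 0 by rewrite gt_eqF// (lt_trans _ conjugate_gt1).
have : p * q * (p^-1 + q^-1) = p * q by rewrite pq_conj mulr1.
have -> : p * q * (p^-1 + q^-1) = p + q by field; rewrite p0 q0.
by lra.
Qed.

Lemma powR_conjugate (a : R) : (a `^ (p - 1)) `^ q = a `^ p.
Proof.
by rewrite -powRrM; congr (_ `^ _); have := conjugateM; lra.
Qed.

Lemma powR_conjugateK (a : R) : 0 <= a -> (a `^ (p - 1)) `^ (q - 1) = a.
Proof. by move=> a0; rewrite -powRrM conjugateM powRr1. Qed.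

Lemma powRB1M (a : R) : 0 <= a -> a `^ (p - 1) * a = a `^ p.
Proof.
move=> a0; rewrite -[X in _ * X](powRr1 a0) -powRD ?subrK//.
by rewrite gt_eqF// (lt_trans _ p_gt1).
Qed.

End duality.

(** Convergence of powers including the limit 0, where the logarithm is useless. *)
Lemma cvg_powR {R : realType} (u : nat -> R) (a r : R) : 0 < r ->
  (forall n, 0 <= u n) -> u @ \oo --> a -> u n `^ r @[n --> \oo] --> a `^ r.
Proof.
move=> r0 u0 ua; have a0 : 0 <= a by apply: (cvgr_to_ge ua); exact: nearW.
have [a00|aN0] := eqVneq a 0.
  rewrite a00 in ua *; rewrite powR0 ?gt_eqF//; apply/cvgr0Pnorm_le => e e0.
  have er0 : 0 < e `^ r^-1 by rewrite powR_gt0.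
  move/cvgrPdist_le : ua => /(_ _ er0); apply: filterS => n.
  rewrite sub0r normrN ger0_norm// => un; rewrite ger0_norm ?powR_ge0//.
  have -> : e = (e `^ r^-1) `^ r.
    by rewrite -powRrM mulVf ?gt_eqF// powRr1// ltW.
  by apply: ge0_ler_powR => //; rewrite ?nnegrE// ?ltW.
have agt : 0 < a by rewrite lt_neqAle eq_sym aN0.
have lnua : expR (r * ln (u n)) @[n --> \oo] --> expR (r * ln a).
  apply: continuous_cvg; first exact: continuous_expR.
  apply: cvgMr; apply: continuous_cvg; [exact: continuous_ln|exact: ua].
rewrite {2}/powR (negbTE aN0); apply: cvg_trans lnua; apply: near_eq_cvg.
near=> n; rewrite /powR gt_eqF//; near: n; exact: (cvgr_gt _ ua).
Unshelve. all: by end_near.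
Qed.

Section duality_map.
Context {R : realType} {V : normedModType R} {p : R}.
Hypotheses (p_gt1 : 1 < p) (V_smooth : uniformly_smooth V).
Implicit Types (x z : V) (f g : dual V).

(** With [duality_map_norming], this reduces the duality map to norming
    functionals: it is [|x|^(p - 1)] times them. *)
Lemma norming_duality_map x f :
  `|f| <= 1 -> f x = `|x| -> duality_map p x (`|x| `^ (p - 1) *: f).
Proof.
move=> f1 fx; set c := `|x| `^ (p - 1).
suff cf : `|c *: f| = c by split; rewrite ?dualZE ?fx cf// mulrC.
rewrite normrZ ger0_norm ?powR_ge0// /c.
have [->|x0] := eqVneq x 0.
  by rewrite normr0 powR0 ?mul0r// subr_eq0 gt_eqF.
suff -> : `|f| = 1 by rewrite mulr1.
apply/le_anti; rewrite f1/= -(@ler_pM2r _ `|x|) ?normr_gt0// mul1r -[leLHS]fx.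
exact: dual_le.
Qed.

Lemma duality_map_norming x f : duality_map p x f ->
  exists g, [/\ `|g| <= 1, g x = `|x| & f = `|x| `^ (p - 1) *: g].
Proof.
move=> [fx fn]; have [x0|x0] := eqVneq x 0.
  have p10 : p - 1 != 0 by rewrite subr_eq0 gt_eqF.
  exists 0; rewrite x0 scaler0; split; rewrite ?normr0//.
  by apply/eqP; rewrite -normr_eq0 fn x0 normr0 powR0.
have xgt : 0 < `|x| `^ (p - 1) by rewrite powR_gt0// normr_gt0.
exists ((`|x| `^ (p - 1))^-1 *: f); split.
- by rewrite normrZ normfV gtr0_norm// fn mulVf// gt_eqF.
- by rewrite dualZE fx fn mulrCA mulVf ?gt_eqF// mulr1.
- by rewrite scalerA divff ?gt_eqF// scale1r.
Qed.

Lemma duality_map_uniq x f g : duality_map p x f -> duality_map p x g -> f = g.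
Proof.
move=> /duality_map_norming[f' [f1 fx ->]] /duality_map_norming[g' [g1 gx ->]].
have [->|x0] := eqVneq x 0.
  by rewrite normr0 powR0 ?scale0r// subr_eq0 gt_eqF.
congr (_ *: _); apply/subr0_eq/normr0_eq0/le_anti; rewrite normr_ge0 andbT.
apply/ler_addgt0Pr => e e0; rewrite add0r.
have [d d0 dP] := norming_functional_close V_smooth e e0.
by apply: (dP x x) => //; rewrite subrr normr0 mulr_ge0// ltW.
Qed.

Lemma JP x : duality_map p x (J p x).
Proof.
apply: xgetPex; have [f f1 fx] := norming_functional V_smooth x.
by exists (`|x| `^ (p - 1) *: f); exact: norming_duality_map.
Qed.

Lemma J_eq x f : duality_map p x f -> J p x = f.
Proof. by move=> xf; apply: (duality_map_uniq x) => //; exact: JP. Qed.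

Lemma J_norm x : `|J p x| = `|x| `^ (p - 1).
Proof. by case: (JP x). Qed.

Lemma J_diag x : J p x x = `|x| `^ p.
Proof. by case: (JP x) => -> ->; rewrite mulrC powRB1M. Qed.

Lemma J_cvg (u : nat -> V) x :
  u @ \oo --> x -> `|J p (u n) - J p x| @[n --> \oo] --> (0 : R).
Proof.
move=> ux; have nux : `|u n| @[n --> \oo] --> `|x| by exact: cvg_norm.
have p10 : 0 < p - 1 by rewrite subr_gt0.
have [x0|x0] := eqVneq x 0.
  have -> : J p x = 0.
    by apply/normr0_eq0; rewrite J_norm x0 normr0 powR0// gt_eqF.
  have := cvg_powR _ _ _ p10 (fun n => normr_ge0 (u n)) nux.
  rewrite x0 normr0 powR0 ?gt_eqF//; apply: cvg_trans; apply: near_eq_cvg.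
  by apply: nearW => n; rewrite subr0 J_norm.
have [g [g1 gx Jx]] := duality_map_norming _ _ (JP x).
have xgt : 0 < `|x| by rewrite normr_gt0.
set c := `|x| `^ (p - 1) in Jx; have c0 : 0 < c by rewrite powR_gt0.
apply/cvgr0Pnorm_le => e e0.
have ec0 : 0 < e / (2 * c) by rewrite divr_gt0// mulr_gt0.
have [d d0 dP] := norming_functional_close V_smooth _ ec0.
have e20 : 0 < e / 2 by rewrite divr_gt0.
have := cvg_powR _ _ _ p10 (fun n => normr_ge0 (u n)) nux.
move/cvgrPdist_le => /(_ _ e20) unc.
have dx0 : 0 < d * `|x| by rewrite mulr_gt0.
move/cvgrPdist_le : ux => /(_ _ dx0) unx.
apply: filterS2 unc unx => n unc; rewrite distrC => unx.
rewrite normr_id.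
have [gn [gn1 gnx ->]] := duality_map_norming _ _ (JP (u n)).
have gng : `|gn - g| <= e / (2 * c) by exact: (dP (u n) x).
set cn := `|u n| `^ (p - 1) in unc *; rewrite Jx.
have -> : cn *: gn - c *: g = (cn - c) *: gn + c *: (gn - g).
  by rewrite scalerBl scalerBr addrA subrK.
apply: (le_trans (ler_normD _ _)); rewrite !normrZ (gtr0_norm c0).
have -> : e = e / 2 + c * (e / (2 * c)) by field; rewrite gt_eqF.
apply: lerD; last by rewrite ler_pM2l.
by rewrite distrC (le_trans _ unc)// ler_piMr.
Qed.

End duality_map.

(** * Bregman distances *)

Section power_smooth.
Context {R : realType} {V : normedModType R} {p q G : R}.
Hypotheses (p_gt1 : 1 < p) (pq_conj : p^-1 + q^-1 = 1) (G_gt0 : 0 < G).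
Hypothesis G_bound :
  forall z w : V, bregman q p z w <= G / q * `|w - z| `^ q.

Let q_gt1 : 1 < q. Proof. exact: conjugate_gt1 p_gt1 pq_conj. Qed.
Let p_gt0 : 0 < p. Proof. exact: lt_trans p_gt1. Qed.
Let q_gt0 : 0 < q. Proof. exact: lt_trans q_gt1. Qed.
Let qp_conj : q^-1 + p^-1 = 1. Proof. by rewrite addrC. Qed.

(** The duality map consists of subgradients of [q^-1 |.|^q], by Young's
    inequality. *)
Lemma duality_map_subgradient (z w : V) (u : dual V) : duality_map q z u ->
  u (w - z) <= q^-1 * `|w| `^ q - q^-1 * `|z| `^ q.
Proof.
move=> [uz un].
have uzq : u z = `|z| `^ q by rewrite uz un mulrC powRB1M.
have upq : `|u| `^ p = `|z| `^ q by rewrite un (powR_conjugate q_gt1 qp_conj).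
have := conjugate_powR (normr_ge0 u) (normr_ge0 w) p_gt0 q_gt0 pq_conj.
have := dual_le u w; rewrite linearB/= uzq upq.
have -> : p^-1 = 1 - q^-1 by rewrite -pq_conj addrK.
by rewrite [_ / q]mulrC; lra.
Qed.

(** The increment of [q^-1 |.|^q] from [z] to [z + h] is at least [u h] by the
    subgradient inequality and at most [J q z h + O(|h|^q)] by the assumed bound.
    As [1 < q], replacing [h] by [t h] with [t] small gives [u h <= J q z h]. *)
Lemma power_smooth_J_uniq (z : V) (u : dual V) : duality_map q z u -> J q z = u.
Proof.
move=> zu; have zJ : duality_map q z (J q z) by apply: xgetPex; exists u.
have Jz : J q z z = `|z| `^ q by case: zJ => -> ->; rewrite mulrC powRB1M.
have le h : (u - J q z) h <= G / q * `|h| `^ q.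
  have := G_bound z (z + h); have := duality_map_subgradient z (z + h) u zu.
  rewrite /bregman dualBE addrC addKr linearD/= Jz.
  have -> : p^-1 = 1 - q^-1 by rewrite -pq_conj addrK.
  by lra.
have q10 : 0 < q - 1 by rewrite subr_gt0.
apply/esym/subr0_eq/normr0_eq0/le_anti; rewrite normr_ge0 andbT.
apply: dual_norm_le => h _; apply/ler_addgt0Pr => e e0; rewrite add0r.
pose c := G / q * `|h| `^ q + 1.
have c0 : 0 < c by rewrite ltr_wpDl// mulr_ge0 ?powR_ge0// divr_ge0// ltW.
(* Chosen so that [c t^(q - 1) = e]. *)
pose t := (e / c) `^ (q - 1)^-1.
have t0 : 0 < t by rewrite powR_gt0// divr_gt0.
have := le (t *: h); rewrite linearZ/= normrZ (gtr0_norm t0) powRM ?(ltW t0)//.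
rewrite -(powRB1M q_gt1 _ (ltW t0)) /t -powRrM mulVf ?gt_eqF// powRr1; last first.
  by rewrite divr_ge0// ltW.
rewrite -/t => H.
have {}H : t * (u - J q z) h <= t * (G / q * `|h| `^ q * (e / c)).
  by apply: (le_trans H); rewrite le_eqVlt; apply/orP; left; apply/eqP; ring.
rewrite ler_pM2l// in H; apply: (le_trans H).
rewrite mulrA ler_pdivrMr// mulrC ler_pM2l//.
by rewrite /c lerDl.
Qed.

End power_smooth.

Section reflexivity.
Context {R : realType} {X : completeNormedModType R} {p q G : R}.
Hypotheses (p_gt1 : 1 < p) (pq_conj : p^-1 + q^-1 = 1) (G_gt0 : 0 < G).
Hypotheses (X_convex : p_convex X p) (X_smooth : uniformly_smooth X).
Hypothesis G_bound :
  forall z w : dual X, bregman q p z w <= G / q * `|w - z| `^ q.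

Let q_gt1 : 1 < q. Proof. exact: conjugate_gt1 p_gt1 pq_conj. Qed.
Let p_gt0 : 0 < p. Proof. exact: lt_trans p_gt1. Qed.
Let q_gt0 : 0 < q. Proof. exact: lt_trans q_gt1. Qed.
Let qp_conj : q^-1 + p^-1 = 1. Proof. by rewrite addrC. Qed.

Lemma bidual_embed_norm (x : X) : `|bidual_embed x| = `|x|.
Proof.
apply/le_anti/andP; split.
  apply: dual_norm_le => f f1; exact: (dual_le1 f x f1).
have [f f1 fx] := norming_functional X_smooth x.
rewrite -[leLHS]fx; apply: (le_trans (dual_le (bidual_embed x) f)).
by rewrite ler_piMr.
Qed.

Lemma bidual_embedK (x : X) : of_bidual (bidual_embed x) = x.
Proof.
have : bidual_embed (of_bidual (bidual_embed x)) = bidual_embed x.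
  apply: (@xgetPex _ 0 [set z | bidual_embed z = bidual_embed x]).
  by exists x.
set z := of_bidual _ => zx.
have zxf (f : dual X) : f z = f x.
  by have /(congr1 (fun u : dual (dual X) => u f)) := zx.
have [f _ fzx] := norming_functional X_smooth (z - x).
by apply/subr0_eq/normr0_eq0; rewrite -fzx linearB/= zxf subrr.
Qed.

Lemma J_J (x : X) : J q (J p x) = bidual_embed x.
Proof.
apply: (power_smooth_J_uniq p_gt1 pq_conj G_gt0 G_bound).
have [Jx Jn] := JP p_gt1 X_smooth x.
split; first by rewrite bidual_embed_norm mulrC -Jx.
by rewrite bidual_embed_norm Jn powR_conjugateK.
Qed.

(** A multiple of a vector where [f] attains its norm is mapped to [f]. *)
Lemma J_surjective (f : dual X) : exists x : X, J p x = f.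
Proof.
have [e e1 fe] := p_convex_norm_attained f X_convex.
exists (`|f| `^ (q - 1) *: e); apply: J_eq => //.
have fq0 : 0 <= `|f| `^ (q - 1) by exact: powR_ge0.
have ne : `| `|f| `^ (q - 1) *: e| = `|f| `^ (q - 1).
  rewrite normrZ ger0_norm//; have [f0|f0] := eqVneq f 0.
    by rewrite f0 normr0 powR0 ?mul0r// subr_eq0 gt_eqF.
  have fgt : 0 < `|f| by rewrite normr_gt0.
  suff -> : `|e| = 1 by rewrite mulr1.
  apply/le_anti; rewrite e1/= -(ler_pM2l fgt) mulr1 -[leLHS]fe.
  exact: dual_le.
split; first by rewrite ne linearZ/= fe.
by rewrite ne (powR_conjugateK q_gt1 qp_conj).
Qed.

(** Both halves of the mirror step cancel: the space is reflexive, and [J q] on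
    the dual is inverse to [J p]. *)
Lemma J_of_bidual (f : dual X) : J p (of_bidual (J q f)) = f.
Proof. by have [x <-] := J_surjective f; rewrite J_J bidual_embedK. Qed.

(** The assumed inequality is an upper bound for the Bregman distance of the
    dual around [J p z]. Evaluate it at [J p z + t h], where [h] norms [w - z],
    and use Young's inequality at [w]; the best [t] gives the constant. *)
Lemma bregman_ge (z w : X) :
  (p * G `^ (p - 1))^-1 * `|z - w| `^ p <= bregman p q z w.
Proof.
have [zw|zw] := eqVneq z w.
  rewrite zw subrr normr0 powR0 ?gt_eqF// mulr0 /bregman J_diag//.
  by rewrite -mulrDl qp_conj mul1r subrr.
have zwgt : 0 < `|w - z| by rewrite normr_gt0 subr_eq0 eq_sym.
have [h h1 hwz] := norming_functional X_smooth (w - z).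
(* The maximiser of [t |w - z| - (G / q) t^q]. *)
pose t := (`|w - z| / G) `^ (p - 1).
have t0 : 0 <= t by exact: powR_ge0.
pose g := J p z + t *: h.
have := G_bound (J p z) g; rewrite {1}/bregman J_J.
have -> : bidual_embed z g = J p z z + t * h z by [].
have -> : g - J p z = t *: h by rewrite /g addrC addKr.
have := conjugate_powR (normr_ge0 g) (normr_ge0 w) q_gt0 p_gt0 qp_conj.
have := dual_le g w.
have -> : g w = J p z w + t * h w by [].
have th : G / q * `|t *: h| `^ q <= q^-1 * (t * `|w - z|).
  have tG : t * `|w - z| = G * t `^ q.
    have -> : `|w - z| = G * (`|w - z| / G) by field; rewrite gt_eqF.
    rewrite /t mulrCA (powRB1M p_gt1) ?divr_ge0 ?ltW//.
    by rewrite (powR_conjugate p_gt1 pq_conj).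
  rewrite tG mulrA [q^-1 * G]mulrC ler_pM2l ?divr_gt0//.
  apply: ge0_ler_powR; rewrite ?nnegrE//; first exact: ltW.
  by rewrite normrZ ger0_norm// ler_piMr.
have Jn : `|J p z| `^ q = `|z| `^ p.
  by rewrite J_norm// (powR_conjugate p_gt1 pq_conj).
have hwz' : h w = h z + `|w - z| by rewrite -hwz linearB/= subrKC.
have -> : (p * G `^ (p - 1))^-1 * `|z - w| `^ p = p^-1 * (t * `|w - z|).
  rewrite /t powRM ?invr_ge0 ?(ltW G_gt0)// distrC -(powRB1M p_gt1)//.
  have -> : G^-1 `^ (p - 1) = (G `^ (p - 1))^-1.
    by rewrite -[G^-1]powR_inv1 ?(ltW G_gt0)// -powRrM mulN1r powRN.
  by field; rewrite !gt_eqF//= powR_gt0.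
rewrite /bregman hwz' J_diag// Jn.
have -> : p^-1 = 1 - q^-1 by rewrite -pq_conj addrK.
move: th; rewrite [`|g| `^ q / q]mulrC mulrDr.
set a := t * `|w - z|; lra.
Qed.

Lemma bregman_refl (z : X) : bregman p q z z = 0.
Proof. by rewrite /bregman J_diag// -mulrDl qp_conj mul1r subrr. Qed.

Lemma bregman_ge0 (z w : X) : 0 <= bregman p q z w.
Proof.
apply: le_trans (bregman_ge z w); rewrite mulr_ge0 ?powR_ge0// invr_ge0.
by rewrite mulr_ge0 ?powR_ge0// ltW.
Qed.

Lemma bregman_three_point (m l w : X) :
  bregman p q m w = bregman p q m l + bregman p q l w + (J p m - J p l) (l - w).
Proof.
rewrite /bregman dualBE !linearB/= J_diag//.
have -> : p^-1 = 1 - q^-1 by rewrite -pq_conj addrK.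
by ring.
Qed.

(** The sum of the distances from [z] to [w] and from [w] to [z] is
    [(J z - J w) (z - w)]. *)
Lemma bregman_le (z w : X) :
  bregman p q z w <= (`|z| `^ (p - 1) + `|w| `^ (p - 1)) * `|z - w|.
Proof.
have := bregman_three_point z w z; rewrite bregman_refl.
have := bregman_ge0 w z; have := dual_le (J p w - J p z) (w - z).
have : `|J p w - J p z| * `|w - z| <=
    (`|z| `^ (p - 1) + `|w| `^ (p - 1)) * `|z - w|.
  rewrite [`|w - z|]distrC ler_wpM2r//.
  by rewrite (le_trans (ler_normB _ _))// !J_norm// addrC.
rewrite !dualBE; lra.
Qed.

(** Only the dual points move when [w] is fixed, so the assumed inequality in
    the dual controls the change of the Bregman distance. *)
Lemma bregman_step (x x' w : X) :
  bregman p q x' w <= bregman p q x w + (J p x' - J p x) (x - w)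
    + G / q * `|J p x' - J p x| `^ q.
Proof.
have := G_bound (J p x) (J p x'); rewrite {1}/bregman J_J.
have -> : bidual_embed x (J p x') = J p x' x by [].
have Jn (z : X) : `|J p z| `^ q = `|z| `^ p.
  by rewrite J_norm// (powR_conjugate p_gt1 pq_conj).
rewrite /bregman dualBE !linearB/= J_diag// !Jn.
have -> : p^-1 = 1 - q^-1 by rewrite -pq_conj addrK.
by lra.
Qed.

End reflexivity.

(** * Deterministic analysis of one path *)

(** Take the first index where [a] goes below the least of [a 0], ...,
    [a n.-1] and [e]. *)
Lemma record_index {R : realType} (a : nat -> R) (n : nat) (e : R) :
  (forall j, 0 < a j) -> 0 < e -> (forall e' : R, 0 < e' -> exists l, a l < e') ->
  exists l, [/\ (n <= l)%N, a l < e & forall j, (j < l)%N -> a l <= a j].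
Proof.
move=> a0 e0 a_small; pose d := \big[Num.min/e]_(j < n) a j.
have d0 : 0 < d by apply: lt_bigmin.
have ex : exists l, a l < d by exact: a_small.
case: (ex_minnP ex) => l ald lmin; exists l; split.
- rewrite leqNgt; apply/negP => ln; move: ald; rewrite ltNge => /negP; apply.
  exact: (bigmin_le _ (Ordinal ln)).
- by apply: lt_le_trans ald _; exact: bigmin_le_id.
- move=> j jl; apply: (le_trans (ltW ald)); rewrite leNgt; apply/negP => /lmin.
  by rewrite leqNgt jl.
Qed.

Section pathwise.
Context {R : realType} {X : completeNormedModType R} {p q G : R}.
Hypotheses (p_gt1 : 1 < p) (pq_conj : p^-1 + q^-1 = 1) (G_gt0 : 0 < G).
Hypotheses (X_convex : p_convex X p) (X_smooth : uniformly_smooth X).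
Hypothesis G_bound :
  forall z w : dual X, bregman q p z w <= G / q * `|w - z| `^ q.

Context {N : nat} {Y : 'I_N -> normedModType R}.
Context {F : forall i, X -> Y i} {y : forall i, Y i} {S : set X}.
Context {dF : forall i, X -> bounded_op X (Y i)} {gamma Lmax : R}.
Context {jp : forall i, Y i -> dual (Y i)}.
Hypothesis jp_selection : forall i (v : Y i), duality_map p v (jp i v).
Hypothesis dF_bound : forall i x, S x -> `|dF i x| <= Lmax.
Hypotheses (gamma_ge0 : 0 <= gamma) (gamma_lt1 : gamma < 1).
Hypothesis tangential_cone : forall i x x', S x -> S x' ->
  `|F i x - F i x' - dF i x (x - x')| <= gamma * `|F i x - F i x'|.

Let q_gt1 : 1 < q. Proof. exact: conjugate_gt1 p_gt1 pq_conj. Qed.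
Let p_gt0 : 0 < p. Proof. exact: lt_trans p_gt1. Qed.
Let q_gt0 : 0 < q. Proof. exact: lt_trans q_gt1. Qed.

Let bregman0 (z w : X) : 0 <= bregman p q z w.
Proof. exact: bregman_ge0 p_gt1 pq_conj G_gt0 X_smooth G_bound z w. Qed.

Definition residual (x : X) : R := \big[Num.max/0]_(i < N) `|F i x - y i|.

Lemma residual_ge i x : `|F i x - y i| <= residual x.
Proof. exact: (le_bigmax _ (fun i => `|F i x - y i|)). Qed.

Lemma residual_ge0 x : 0 <= residual x.
Proof. by apply: bigmax_ge_id. Qed.

Lemma tangential_cone_le i x x' : S x -> S x' ->
  `|dF i x (x - x')| <= (1 + gamma) * `|F i x - F i x'|.
Proof.
move=> Sx Sx'; have := tangential_cone i x x' Sx Sx'.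
have := ler_normB (F i x - F i x') (F i x - F i x' - dF i x (x - x')).
by rewrite subKr; lra.
Qed.

Lemma tangential_cone_lipschitz i x x' : S x -> S x' ->
  `|F i x - F i x'| <= Lmax / (1 - gamma) * `|x - x'|.
Proof.
move=> Sx Sx'; have := tangential_cone i x x' Sx Sx'.
have := ler_normD (F i x - F i x' - dF i x (x - x')) (dF i x (x - x')).
rewrite subrK => H1 H2; have g1 : 0 < 1 - gamma by rewrite subr_gt0.
rewrite mulrAC ler_pdivlMr//.
have : `|dF i x (x - x')| <= Lmax * `|x - x'|.
  by rewrite (le_trans (le_op_norm _ _))// ler_wpM2r// dF_bound.
by move: H1 H2; lra.
Qed.

Lemma jp_norm i (v : Y i) : `|jp i v| = `|v| `^ (p - 1).
Proof. by case: (jp_selection i v). Qed.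

Lemma jp_diag i (v : Y i) : jp i v v = `|v| `^ p.
Proof. by case: (jp_selection i v) => -> ->; rewrite mulrC powRB1M. Qed.

(** One step of the method, seen in the dual, where it is additive. *)
Definition dual_step (mu : R) i (x x' : X) :=
  J p x' = J p x - mu *: adjoint (dF i x) (jp i (F i x - y i)).

Lemma dual_stepE mu i x x' h : dual_step mu i x x' ->
  (J p x' - J p x) h = - (mu * jp i (F i x - y i) (dF i x h)).
Proof. by move=> ->; rewrite addrC addKr. Qed.

(** The first order term of [bregman_step] is [- mu] times
    [jp r (dF i x (x - w))] with [r = F i x - y i]. The tangential cone condition
    replaces [dF i x (x - w)] by [r] with relative error [gamma], and the
    bound on the step size absorbs the second order term. *)
Lemma bregman_descent (C mu : R) i x x' w :
  C <= 1 - gamma - Lmax `^ q * (G / q) * mu `^ (q - 1) -> 0 < mu ->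
  S x -> S w -> F i w = y i -> dual_step mu i x x' ->
  bregman p q x' w <= bregman p q x w - C * (mu * `|F i x - y i| `^ p).
Proof.
move=> hC mu0 Sx Sw Fw xx'.
have := bregman_step p_gt1 pq_conj G_gt0 X_smooth G_bound x x' w.
rewrite (dual_stepE _ _ _ _ _ xx').
have -> : J p x' - J p x = - (mu *: adjoint (dF i x) (jp i (F i x - y i))).
  by rewrite xx' addrC addKr.
set r := F i x - y i; set phi := adjoint _ _.
have L0 : 0 <= Lmax by apply: le_trans (dF_bound i x Sx).
have phi_le : `|phi| <= Lmax * `|r| `^ (p - 1).
  apply: dual_norm_le => h h1; have -> : phi h = jp i r (dF i x h) by [].
  apply: (le_trans (dual_le _ _)); rewrite jp_norm mulrC ler_wpM2r ?powR_ge0//.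
  apply: (le_trans (le_op_norm _ _)); rewrite -[leRHS]mulr1.
  by apply: ler_pM => //; [exact: op_norm_ge0|exact: (dF_bound i x Sx)].
have phiq : G / q * `|- (mu *: phi)| `^ q <=
    mu * `|r| `^ p * (Lmax `^ q * (G / q) * mu `^ (q - 1)).
  rewrite normrN normrZ gtr0_norm//.
  apply: (@le_trans _ _ (G / q * (mu * (Lmax * `|r| `^ (p - 1))) `^ q)).
    rewrite ler_wpM2l ?divr_ge0 ?(ltW G_gt0) ?(ltW q_gt0)//.
    apply: ge0_ler_powR; rewrite ?nnegrE ?mulr_ge0 ?powR_ge0 ?ler_pM2l//.
    - exact: ltW.
    - exact: ltW.
    - exact: ltW.
  rewrite !powRM ?mulr_ge0 ?powR_ge0 ?(ltW mu0)//.
  rewrite (powR_conjugate p_gt1 pq_conj) -(powRB1M q_gt1 mu (ltW mu0)).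
  by rewrite le_eqVlt; apply/orP; left; apply/eqP; ring.
have pair : (1 - gamma) * `|r| `^ p <= jp i r (dF i x (x - w)).
  have := tangential_cone i x w Sx Sw; rewrite Fw -/r => tc.
  have := dual_le (jp i r) (r - dF i x (x - w)).
  rewrite linearB/= jp_diag jp_norm.
  have : `|r| `^ (p - 1) * `|r - dF i x (x - w)| <= gamma * `|r| `^ p.
    rewrite -(powRB1M p_gt1)// mulrCA ler_wpM2l ?powR_ge0//.
  lra.
have rp0 : 0 <= mu * `|r| `^ p by rewrite mulr_ge0 ?powR_ge0// ltW.
have := ler_wpM2l rp0 hC; have := ler_wpM2l (ltW mu0) pair.
move: phiq; set a := _ * _ * mu `^ (q - 1); set b := `|r| `^ p.
set e := jp i r _; set f := _ `^ q.
have -> : mu * b * (1 - gamma - a) = mu * ((1 - gamma) * b) - mu * b * a by ring.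
have -> : C * (mu * b) = mu * b * C by ring.
by lra.
Qed.

Section orbit.
Context {C nu : R} {xdag : X} {x : nat -> X} {mu : nat -> R} {idx : nat -> 'I_N}.
Hypotheses (C_gt0 : 0 < C) (mu_gt0 : forall k, 0 < mu k).
Hypothesis mu_bound : forall k,
  C <= 1 - gamma - Lmax `^ q * (G / q) * mu k `^ (q - 1).
Hypotheses (xdag_in : S xdag) (xdag_sol : forall i, F i xdag = y i).
Hypothesis ball_sub : bregman_ball p q nu xdag `<=` S.
Hypothesis x0_ball : bregman_ball p q nu xdag (x 0).
Hypothesis x_step : forall k, dual_step (mu k) (idx k) (x k) (x k.+1).

Local Notation B k := (bregman p q (x k) xdag).

Lemma bregman_orbit_ball k : bregman_ball p q nu xdag (x k).
Proof.
elim: k => // k IHk.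
apply: le_trans (bregman_descent _ _ _ _ _ _ (mu_bound k) (mu_gt0 k)
  (ball_sub _ IHk) xdag_in (xdag_sol _) (x_step k)) _.
apply: le_trans IHk; rewrite gerBl mulr_ge0 ?(ltW C_gt0)//.
by rewrite mulr_ge0 ?powR_ge0// ltW.
Qed.

Lemma orbit_in k : S (x k).
Proof. exact/ball_sub/bregman_orbit_ball. Qed.

Lemma bregman_orbit_noninc m l : (m <= l)%N -> B l <= B m.
Proof.
move=> ml; rewrite -(subnKC ml); elim: (l - m)%N => [|k]; first by rewrite addn0.
apply: le_trans; rewrite addnS.
apply: le_trans (bregman_descent _ _ _ _ _ _ (mu_bound _) (mu_gt0 _)
  (orbit_in _) xdag_in (xdag_sol _) (x_step _)) _.
rewrite gerBl mulr_ge0 ?(ltW C_gt0)//.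
by rewrite mulr_ge0 ?powR_ge0// ltW.
Qed.

Local Notation cost k := (mu k * residual (x k) `^ p).

Let cost_ge0 k : 0 <= cost k.
Proof. by rewrite mulr_ge0 ?powR_ge0// ltW. Qed.

(** Every increment of [J p (x j)] tests [dF i (x j)] against
    [x l - xdag = (x j - xdag) - (x j - x l)], which the tangential cone
    condition bounds by residuals at [x j] and [x l]. The record property
    replaces the latter by the former. *)
Lemma orbit_pairing m l : (m <= l)%N ->
  (forall j, (j < l)%N -> residual (x l) <= residual (x j)) ->
  (J p (x l) - J p (x m)) (x l - xdag) <=
    3 * (1 + gamma) * \sum_(m <= j < l) cost j.
Proof.
move=> ml rec; rewrite mulr_sumr.
suff H k : (m <= k)%N -> (k <= l)%N ->
    (J p (x k) - J p (x m)) (x l - xdag) <=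
    \sum_(m <= j < k) 3 * (1 + gamma) * cost j by exact: H.
elim: k => [|k IHk] mk kl.
  by move: mk; rewrite leqn0 => /eqP ->; rewrite subrr big_geq.
move: mk; rewrite leq_eqVlt => /predU1P[->|mk]; first by rewrite subrr big_geq.
rewrite ltnS in mk; rewrite big_nat_recr// [leRHS]/=.
have -> : (J p (x k.+1) - J p (x m)) (x l - xdag) =
    (J p (x k) - J p (x m)) (x l - xdag) +
    (J p (x k.+1) - J p (x k)) (x l - xdag).
  by rewrite !dualBE; ring.
apply: lerD; first exact: IHk (ltnW kl).
rewrite (dual_stepE _ _ _ _ _ (x_step k)) -mulrN.
set i := idx k; set r := F i (x k) - y i.
rewrite mulrCA ler_pM2l//.
have res0 := residual_ge0 (x k).
have rk : `|r| <= residual (x k) by exact: residual_ge.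
have g10 : 0 <= 1 + gamma by rewrite addr_ge0.
have Ah : `|dF i (x k) (x l - xdag)| <= 3 * (1 + gamma) * residual (x k).
  have -> : x l - xdag = (x k - xdag) - (x k - x l).
    by rewrite opprB [RHS]addrC addrA subrK.
  rewrite linearB/=; apply: (le_trans (ler_normB _ _)).
  have := tangential_cone_le i (x k) xdag (orbit_in _) xdag_in.
  have := tangential_cone_le i (x k) (x l) (orbit_in _) (orbit_in _).
  have rl : `|F i (x l) - y i| <= residual (x k).
    by rewrite (le_trans (residual_ge i (x l)))// rec.
  have : `|F i (x k) - F i (x l)| <= 2 * residual (x k).
    have -> : F i (x k) - F i (x l) = r - (F i (x l) - y i).
      by rewrite /r opprB addrA subrK.
    by rewrite (le_trans (ler_normB _ _))// mulr_natl mulr2n lerD.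
  rewrite xdag_sol -/r => /(ler_wpM2l g10) H1 H2 H3.
  move: rk => /(ler_wpM2l g10).
  set a := (1 + gamma) * _ in H1 H2 *.
  by lra.
apply: (le_trans (ler_norm _)); rewrite normrN.
apply: (le_trans (le_op_norm (jp i r) _)).
rewrite -[op_norm _]/(`|jp i r|) jp_norm.
rewrite -(powRB1M p_gt1)// mulrCA.
apply: ler_pM; rewrite ?powR_ge0//.
by apply: ge0_ler_powR; rewrite ?nnegrE// subr_ge0 ltW.
Qed.

Hypothesis S_closed : closed S.
Hypothesis dF_null : forall z h, S z ->
  (forall i, dF i xdag h = 0) -> forall i, dF i z h = 0.
Hypothesis xdag_min : forall z, S z -> (forall i, F i z = y i) ->
  bregman p q (x 0) xdag <= bregman p q (x 0) z.
Hypothesis mu_sum : forall M : R, exists n, M < \sum_(0 <= k < n) mu k.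

(** The tangential cone condition between the two solutions [xdag] and [z] puts
    their difference in the null space of every derivative. So [J p (x k)]
    and [J p (x 0)] agree on it, the difference of the two Bregman distances does
    not depend on [k], and it has the right sign at [k = 0]. *)
Lemma bregman_orbit_le_solution z k : S z -> (forall i, F i z = y i) ->
  B k <= bregman p q (x k) z.
Proof.
move=> Sz Fz.
have null i : dF i xdag (xdag - z) = 0.
  apply/normr0_eq0/le_anti; rewrite normr_ge0 andbT.
  apply: (le_trans (tangential_cone_le i xdag z xdag_in Sz)).
  by rewrite xdag_sol Fz subrr normr0 mulr0.
have Jk : J p (x k) (xdag - z) = J p (x 0) (xdag - z).
  elim: k => // k <-; apply/subr0_eq.
  rewrite -dualBE (dual_stepE _ _ _ _ _ (x_step k)).
  by rewrite (dF_null _ _ (orbit_in k) null) linear0 mulr0 oppr0.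
have := xdag_min z Sz Fz; move: Jk; rewrite /bregman !linearB/=.
by lra.
Qed.

(** Along record indices [l n] the sequence [x] is Cauchy, because
    [c |x m - x (l n)|^p] is at most [T m - T (l n)] for a convergent sequence
    [T]; its limit solves the problem, and [bregman_orbit_le_solution] compares
    [xdag] with it. *)
Lemma bregman_orbit_cvg (M : R) : (forall n, \sum_(0 <= k < n) cost k <= M) ->
  bregman p q (x k) xdag @[k --> \oo] --> (0 : R).
Proof.
move=> costM.
suff B_small e : 0 < e -> exists k, B k <= e.
  apply/cvgr0Pnorm_le => e e0; have [k Bk] := B_small e e0.
  exists k => // n /= kn; rewrite ger0_norm ?bregman0//.
  by apply: le_trans Bk; exact: bregman_orbit_noninc.
(* If some residual vanishes, the orbit has already reached a solution. *)
move=> e0; have [[k xk]|noz] := pselect (exists k, residual (x k) <= 0).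
  exists k; have Fk i : F i (x k) = y i.
    apply/subr0_eq/normr0_eq0/le_anti; rewrite normr_ge0 andbT.
    exact: le_trans (residual_ge i (x k)) xk.
  apply: le_trans (bregman_orbit_le_solution _ k (orbit_in k) Fk) _.
  by rewrite bregman_refl// ltW.
have res_gt0 k : 0 < residual (x k).
  by rewrite ltNge; apply/negP => xk; apply: noz; exists k.
have res_small (d : R) : 0 < d -> exists l, residual (x l) < d.
  move=> d0; apply/not_existsP => res_ge.
  have dp0 : 0 < d `^ p by rewrite powR_gt0.
  have [n] := mu_sum (M / d `^ p); rewrite ltr_pdivrMr// ltNge => /negP; apply.
  apply: le_trans (costM n); rewrite mulr_suml; apply: ler_sum => k _.
  rewrite ler_pM2l//.
  apply: ge0_ler_powR; rewrite ?nnegrE ?residual_ge0 ?(ltW d0) ?(ltW p_gt0)//.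
  by rewrite leNgt; apply/negP; exact: res_ge.
have /choice[l lP] : forall n : nat, exists l, [/\ (n <= l)%N,
    residual (x l) < n.+1%:R^-1 &
    forall j, (j < l)%N -> residual (x l) <= residual (x j)].
  by move=> n; apply: record_index => //; rewrite invr_gt0.
pose K := 3 * (1 + gamma).
have K0 : 0 <= K by rewrite mulr_ge0// addr_ge0.
pose T k := B k - K * \sum_(0 <= j < k) cost j.
pose c := (p * G `^ (p - 1))^-1.
have c0 : 0 < c by rewrite invr_gt0 mulr_gt0// powR_gt0.
have gap m n : (m <= l n)%N -> c * `|x m - x (l n)| `^ p <= T m - T (l n).
  move=> mn.
  apply: le_trans (bregman_ge p_gt1 pq_conj G_gt0 X_smooth G_bound _ _) _.
  have [_ _ rec] := lP n; have := orbit_pairing m (l n) mn rec.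
  rewrite -/K dualBE.
  have := bregman_three_point p_gt1 pq_conj X_smooth (x m) (x (l n)) xdag.
  rewrite dualBE /T (big_cat_nat (leq0n m) mn)/= (mulrDr K).
  by lra.
have Tni : {homo T : m n / (m <= n)%N >-> n <= m}.
  move=> m n mn; have := bregman_orbit_noninc m n mn.
  rewrite /T (big_cat_nat (leq0n m) mn)/= mulrDr.
  have : 0 <= K * \sum_(m <= i < n) cost i by rewrite mulr_ge0// sumr_ge0.
  by lra.
have Tcvg : cvg (T n @[n --> \oo]).
  apply: nonincreasing_is_cvgn => //; exists (- (K * M)) => _ [n _ <-].
  have : 0 <= B n by exact: bregman0.
  have : K * \sum_(0 <= j < n) cost j <= K * M by rewrite ler_wpM2l.
  by rewrite /T; lra.
have [z xz] : exists z : X, x (l n) @[n --> \oo] --> z.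
  apply: cauchy_seq_cvg => d d0.
  have cd0 : 0 < c * d `^ p / 2 by rewrite divr_gt0// mulr_gt0// powR_gt0.
  move/cvgrPdist_le : Tcvg => /(_ _ cd0)[n0 _ n0P].
  exists n0.
  suff wl m n : (n0 <= m)%N -> (n0 <= n)%N -> (l m <= l n)%N ->
      `|x (l m) - x (l n)| <= d.
    move=> m n m0 n0'; have [mn|/ltnW nm] := leqP (l m) (l n); first exact: wl.
    by rewrite distrC; exact: wl.
  move=> m0 n0' mn; rewrite leNgt; apply/negP => dlt.
  have : d `^ p < `|x (l m) - x (l n)| `^ p.
    by apply: gt0_ltr_powR; rewrite ?nnegrE// ltW.
  rewrite -(ltr_pM2l c0) => dlt'.
  have := gap _ _ mn => /(lt_le_trans dlt').
  have lm0 : (n0 <= l m)%N by case: (lP m) => lm _ _; exact: leq_trans lm.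
  have ln0 : (n0 <= l n)%N by case: (lP n) => ln _ _; exact: leq_trans ln.
  have := n0P _ lm0; have := n0P _ ln0; rewrite /= !ler_distl.
  by lra.
have Sz : S z.
  apply: (closed_cvg S S_closed _ _ xz).
  by apply: nearW => n; exact: orbit_in.
have Fz i : F i z = y i.
  apply/subr0_eq/normr0_eq0/le_anti; rewrite normr_ge0 andbT.
  have Lip0 : 0 <= Lmax / (1 - gamma).
    rewrite divr_ge0 ?subr_ge0 ?(ltW gamma_lt1)//.
    exact: le_trans (dF_bound i z Sz).
  have bnd : n.+1%:R^-1 + Lmax / (1 - gamma) * `|z - x (l n)| @[n --> \oo] -->
      0 + Lmax / (1 - gamma) * 0.
    apply: cvgD; first exact: cvg_harmonic.
    apply: cvgMr; rewrite -(normr0 X) -(subrr z); apply: cvg_norm.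
    by apply: cvgB => //; exact: cvg_cst.
  rewrite mulr0 addr0 in bnd; apply: (cvgr_to_ge bnd); apply: nearW => n.
  have [_ ln _] := lP n.
  have -> : F i z - y i = (F i (x (l n)) - y i) + (F i z - F i (x (l n))).
    by rewrite [RHS]addrC addrA subrK.
  apply: (le_trans (ler_normD _ _)); apply: lerD.
    exact: le_trans (residual_ge i (x (l n))) (ltW ln).
  by apply: tangential_cone_lipschitz => //; exact: orbit_in.
have Bz : (`|x (l n)| `^ (p - 1) + `|z| `^ (p - 1)) * `|x (l n) - z|
    @[n --> \oo] --> (`|z| `^ (p - 1) + `|z| `^ (p - 1)) * 0.
  apply: cvgM.
    apply: cvgD; last exact: cvg_cst.
    by apply: cvg_powR => //; [rewrite subr_gt0|exact: cvg_norm].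
  rewrite -(normr0 X) -(subrr z); apply: cvg_norm.
  by apply: cvgB => //; exact: cvg_cst.
rewrite mulr0 in Bz; move/cvgr0Pnorm_le : Bz => /(_ e e0)[n _ nP].
exists (l n); apply: le_trans (bregman_orbit_le_solution z _ Sz Fz) _.
apply: le_trans (bregman_le p_gt1 pq_conj G_gt0 X_smooth G_bound _ _) _.
exact: le_trans (ler_norm _) (nP n (leqnn n)).
Qed.

End orbit.
End pathwise.

(** * Random iterations *)

Section random_iteration.
Context {A : Type} {E : finType} {R : realType}.
Variables (step : nat -> A -> E -> A) (a0 : A).

Fixpoint iteration (e : nat -> E) (k : nat) : A :=
  if k is k'.+1 then step k' (iteration e k') (e k') else a0.

(** The expectation of [psi] at time [k] when the inputs are independent and
    uniform, as a finite average; it keeps all estimates of expectations in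
    [R]. *)
Fixpoint mean (k : nat) (psi : A -> R) : R :=
  if k is k'.+1 then
    #|E|%:R^-1 * \sum_(i : E) mean k' (fun x => psi (step k' x i))
  else psi a0.

Lemma mean_linear k c (f g : A -> R) :
  mean k (fun x => c * f x + g x) = c * mean k f + mean k g.
Proof.
elim: k f g => //= k IHk f g.
under eq_bigr do rewrite IHk.
by rewrite big_split/= -mulr_sumr mulrDr mulrCA.
Qed.

Lemma mean_sum k I (s : seq I) (f : I -> A -> R) :
  mean k (fun x => \sum_(i <- s) f i x) = \sum_(i <- s) mean k (f i).
Proof.
elim: k f => //= k IHk f.
under eq_bigr do rewrite IHk.
by rewrite exchange_big/= mulr_sumr.
Qed.

Lemma mean_le (Q : A -> Prop) k (f g : A -> R) :
  Q a0 -> (forall j x i, Q x -> Q (step j x i)) ->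
  (forall x, Q x -> f x <= g x) -> mean k f <= mean k g.
Proof.
move=> Q0 Qstep; elim: k f g => [|k IHk] f g fg /=; first exact: fg.
rewrite ler_wpM2l ?invr_ge0//; apply: ler_sum => i _.
by apply: IHk => x Qx; apply: fg; exact: Qstep.
Qed.

Lemma mean_ge0 k (f : A -> R) : (forall x, 0 <= f x) -> 0 <= mean k f.
Proof.
elim: k f => [|k IHk] f f0 /=; first exact: f0.
by rewrite mulr_ge0 ?invr_ge0// sumr_ge0// => i _; exact: IHk.
Qed.

Lemma meanS k (f : A -> R) :
  mean k.+1 f = #|E|%:R^-1 * \sum_(i : E) mean k (fun x => f (step k x i)).
Proof. by []. Qed.

Context d (T : measurableType d) (P : probability T R).
Variable xi : nat -> T -> E.
Hypothesis xi_iid : iid_uniform P xi.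

Local Notation z k w := (iteration (xi^~ w) k).

(** The state at time [k] depends on finitely many inputs with finitely many
    values, so every set of states is an event. *)
Lemma measurable_iteration k (B : set A) : measurable [set w | B (z k w)].
Proof.
have [mxi _ _] := xi_iid.
elim: k B => [|k IHk] B.
  have [Ba|nBa] := pselect (B a0).
    by rewrite (_ : mkset _ = setT)//; apply/seteqP; split.
  by rewrite (_ : mkset _ = set0)//; apply/seteqP; split.
rewrite (_ : mkset _ = \bigcup_(i in [set: E])
    ([set w | B (step k (z k w) i)] `&` xi k @^-1` [set i])).
  apply: fin_bigcup_measurable => // i _.
  by apply: measurableI; [exact: (IHk (fun x => B (step k x i)))|exact: mxi].
apply/seteqP; split => w /=.
  by move=> Bw; exists (xi k w).
by move=> [i _ [/= Bw wi]]; rewrite /= wi.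
Qed.

Lemma measurable_fun_iteration k (psi : A -> R) D :
  measurable_fun D (fun w => psi (z k w)).
Proof.
move=> mD B _; apply: measurableI => //.
exact: (measurable_iteration k (psi @^-1` B)).
Qed.

(** The state at time [k] is independent of the inputs from [k] on. The events
    [xi k = i] split the set of integration; each piece is again an
    event of the same form, with one more constraint, so induction on [k]
    applies. *)
Lemma integral_iteration_event k (psi : A -> R) (I : seq nat) (U : nat -> set E) :
  (forall x, 0 <= psi x) -> uniq I -> (forall j, j \in I -> (k <= j)%N) ->
  (\int[P]_(w in \bigcap_(j in [set` I]) (xi j @^-1` U j)) (psi (z k w))%:E =
   (mean k psi)%:E * P (\bigcap_(j in [set` I]) (xi j @^-1` U j)))%E.
Proof.
have [mxi uxi ixi] := xi_iid.
have mev (J : seq nat) (V : nat -> set E) :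
    measurable (\bigcap_(j in [set` J]) (xi j @^-1` V j)).
  by apply: fin_bigcap_measurable; [exact: finite_seq|move=> j _; exact: mxi].
elim: k psi I U => [|k IHk] psi I U psi0 uI kI.
  by have := integral_cst P (mev I U) (psi a0)%:E.
set D := \bigcap_(j in _) _.
pose V i j := if j == k then [set i] else U j.
have kNI : k \notin I by apply/negP => /kI; rewrite ltnn.
have DV i : D `&` xi k @^-1` [set i] =
    \bigcap_(j in [set` k :: I]) (xi j @^-1` V i j).
  apply/seteqP; split => w.
    move=> [Dw /= wi] j /=; rewrite inE => /predU1P[->|jI].
      by rewrite /V eqxx.
    rewrite /V; case: eqVneq => [jk|_]; first by rewrite -jk jI in kNI.
    exact: Dw.
  move=> DVw; split.
    move=> j /= jI; have := DVw j; rewrite /= inE jI orbT => /(_ isT).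
    by rewrite /V; case: eqVneq => [jk|//]; rewrite -jk jI in kNI.
  by have := DVw k; rewrite /= inE eqxx => /(_ isT); rewrite /V eqxx.
have mDV i : measurable (D `&` xi k @^-1` [set i]) by rewrite DV; exact: mev.
have PDV i : P (D `&` xi k @^-1` [set i]) = (#|E|%:R^-1%:E * P D)%E.
  rewrite DV ixi/=; last by rewrite kNI.
  rewrite big_cons {1}/V eqxx uxi ixi//; congr (_ * _)%E.
  apply: eq_big_seq => j jI; rewrite /V; case: eqVneq => // jk.
  by rewrite -jk jI in kNI.
have DU : D = \big[setU/set0]_(i <- enum E) (D `&` xi k @^-1` [set i]).
  rewrite -bigcup_seq; apply/seteqP; split => [w Dw|w [i _ []]//].
  by exists (xi k w); rewrite /= ?mem_enum.
rewrite [in LHS]DU ge0_integral_bigsetU//; last 4 first.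
- exact: enum_uniq.
- apply/trivIsetP => i j _ _ ij; rewrite -subset0 => w [[_ /= ->] [_ /= ji]].
  by move/eqP: ij.
- by apply/measurable_EFinP; exact: measurable_fun_iteration.
- by move=> w _; rewrite lee_fin.
transitivity (\sum_(i <- enum E)
    ((mean k (fun x => psi (step k x i)))%:E * (#|E|%:R^-1%:E * P D)))%E.
  apply: eq_bigr => i _.
  rewrite -(PDV i) DV -IHk//=; last 2 first.
  - by rewrite kNI.
  - by move=> j; rewrite inE => /predU1P[->//|/kI/ltnW].
  rewrite -DV; apply: eq_integral => w; rewrite inE => -[_ /= wi].
  by rewrite /= wi.
rewrite -(fineK (fin_num_measure P D (mev _ _))).
under eq_bigr do rewrite -!EFinM.
rewrite sumEFin -EFinM; congr (_%:E).
rewrite big_enum/= mulr_sumr mulr_suml; apply: eq_bigr => i _.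
by rewrite mulrA [_ * #|E|%:R^-1]mulrC.
Qed.

Lemma expectation_iteration k (psi : A -> R) : (forall x, 0 <= psi x) ->
  ('E_P[fun w => psi (z k w)] = (mean k psi)%:E)%E.
Proof.
move=> psi0; rewrite unlock.
have := @integral_iteration_event k psi [::] (fun=> setT) psi0 isT.
rewrite set_nil bigcap_set0 probability_setT mule1; exact.
Qed.

(** The integral of the sum of the series is the sum of the means, which
    is finite, so the sum is finite almost everywhere. *)
Lemma mean_summable_ae (psi : nat -> A -> R) (M : R) :
  (forall k x, 0 <= psi k x) ->
  (forall n, \sum_(0 <= k < n) mean k (psi k) <= M) ->
  {ae P, forall w, exists M' : R, forall n,
    \sum_(0 <= k < n) psi k (z k w) <= M'}.
Proof.
move=> psi0 psiM; pose g k w := (psi k (z k w))%:E.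
have mg k : measurable_fun setT (g k).
  by apply/measurable_EFinP; exact: measurable_fun_iteration.
have g0 k w : (0 <= g k w)%E by rewrite lee_fin.
have mS : measurable_fun setT (fun w => \sum_(0 <= k <oo) g k w)%E.
  by apply: ge0_emeasurable_sum.
have intg : (\int[P]_w \sum_(0 <= k <oo) g k w <= M%:E)%E.
  rewrite integral_nneseries//; apply: lime_le.
    by apply: is_cvg_nneseries => n _ _; exact: integral_ge0.
  apply: nearW => n.
  rewrite (eq_bigr (fun k => (mean k (psi k))%:E)); first by rewrite sumEFin lee_fin.
  by move=> k _; rewrite -expectation_iteration// unlock.
have ig : P.-integrable setT (fun w => \sum_(0 <= k <oo) g k w)%E.
  apply/integrableP; split => //; apply: le_lt_trans (ltry M).
  rewrite (eq_integral (fun w => \sum_(0 <= k <oo) g k w)%E)// => w _.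
  by rewrite gee0_abs// nneseries_ge0.
apply: filterS (integrable_ae measurableT ig) => w /(_ I) wfin.
exists (fine (\sum_(0 <= k <oo) g k w)%E) => n.
rewrite -lee_fin fineK// -sumEFin.
exact: (nneseries_lim_ge (u_ := fun k => g k w)).
Qed.

End random_iteration.

Lemma expectation_bounded_cvg0 {R : realType} d (T : measurableType d)
    (P : probability T R) (f : nat -> T -> R) (M : R) :
  (forall n, measurable_fun setT (f n)) ->
  (forall n w, 0 <= f n w <= M) ->
  {ae P, forall w, f n w @[n --> \oo] --> (0 : R)} ->
  ('E_P[f n] @[n --> \oo] --> 0)%E.
Proof.
move=> mf fM f0; rewrite unlock.
have [] := @dominated_convergence _ _ _ P setT measurableT
  (fun n w => (f n w)%:E) (fun=> 0%E) (fun=> M%:E).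
- by move=> n; apply/measurable_EFinP.
- exact: measurable_cst.
- apply: filterS f0 => w fw _; by apply: cvg_EFin => //; exact: nearW.
- exact: (finite_measure_integrable_cst P M measurableT).
- apply: aeW => w n _; rewrite /= lee_fin.
  by have /andP[f0' fM'] := fM n w; rewrite ger0_norm.
by move=> _ _; rewrite integral0.
Qed.

(** * Convergence of the stochastic iteration *)

Lemma residual_powR_le {R : realType} {X : completeNormedModType R} {N : nat}
    {Y : 'I_N -> normedModType R} {F : forall i, X -> Y i}
    {y : forall i, Y i} (p : R) (x : X) : 0 < p ->
  residual (F := F) (y := y) x `^ p <= \sum_(i < N) `|F i x - y i| `^ p.
Proof.
move=> p0; rewrite /residual; elim/big_rec : _ => [|i a _ IHa].
  by rewrite powR0 ?gt_eqF// sumr_ge0// => i _; exact: powR_ge0.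
rewrite /Num.max; case: ifP => // _.
rewrite (bigD1 i)//= lerDl sumr_ge0// => j _; exact: powR_ge0.
Qed.

(** The step sizes are indexed from 1; the orbit is indexed from 0. *)
Lemma pinfty_series_gt {R : realType} (u : nat -> R) :
  (forall k, (0 < k)%N -> 0 < u k) -> (\sum_(1 <= k <oo) (u k)%:E = +oo)%E ->
  forall M : R, exists n, M < \sum_(0 <= k < n) u k.+1.
Proof.
move=> u0 uoo M; apply/not_existsP => uM.
suff : (\sum_(1 <= k <oo) (u k)%:E <= M%:E)%E by rewrite uoo.
apply: lime_le.
  by apply: is_cvg_nneseries => n n1 _; rewrite lee_fin ltW// u0.
apply: nearW => n; rewrite sumEFin lee_fin leNgt; apply/negP => Mn.
apply: (uM n.-1); apply: (lt_le_trans Mn).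
by case: n {Mn} => [|n]; [rewrite !big_geq|rewrite big_add1].
Qed.

Theorem theorem4 (R : realType)
    (* spaces and exponents *)
    (s : R) (s_ge1 : 1 <= s) (N : nat) (N_gt0 : (0 < N)%N)
    (X : completeNormedModType R) (Y : 'I_N -> completeNormedModType R)
    (p q : R) (p_gt1 : 1 < p) (pq_conj : p^-1 + q^-1 = 1)
    (X_convex : p_convex X p) (X_smooth : uniformly_smooth X)
    (Y_smooth : uniformly_smooth (lsprod s_ge1 (fun i => Y i)))
    (G : R) (G_gt0 : 0 < G)
    (G_bound : forall z w : dual X, bregman q p z w <= G / q * `|w - z| `^ q)
    (jp : forall i, Y i -> dual (Y i))
    (jp_selection : forall i (v : Y i), duality_map p v (jp i v))
    (* operators, exact data and conditions (i)-(iii) *)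
    (D : 'I_N -> set X) (F : forall i, X -> Y i)
    (y : lsprod s_ge1 (fun i => Y i))
    (S : set X) (S_sub : S `<=` \bigcap_i D i)
    (S_closed : closed S) (S_convex : convex_set S)
    (x0 xdag : X) (nu : R) (nu_gt0 : 0 < nu)
    (xdag_min : minimum_distance_solution p q F y S x0 xdag)
    (ball_sub : bregman_ball p q nu xdag `<=` S)
    (dF : forall i, X -> bounded_op X (Y i))
    (F_diff : forall i x, S x -> frechet_derivative (D i) (F i) x (dF i x))
    (L : 'I_N -> R)
    (dF_bound : forall i x, S x -> `|dF i x| <= L i)
    (gamma : R) (gamma_01 : 0 < gamma < 1)
    (tangential_cone : forall i x x', S x -> S x' ->
      `|F i x - F i x' - dF i x (x - x')| <= gamma * `|F i x - F i x'|)
    (x0_ball : bregman_ball p q nu xdag x0)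
    (* step sizes *)
    (mu : nat -> R) (mu_gt0 : forall k, (0 < k)%N -> 0 < mu k)
    (mu_sum : (\sum_(1 <= k <oo) (mu k)%:E = +oo)%E)
    (C : R) (C_gt0 : 0 < C)
    (mu_bound : forall k, (0 < k)%N ->
      C <= 1 - gamma -
           (\big[Num.max/0]_(i < N) L i) `^ q * (G / q) * mu k `^ (q - 1))
    (* weak-to-weak continuity and null space condition *)
    (F_weak : {within (\bigcap_i D i : set (weak X)),
      continuous (stack s_ge1 F : weak X -> weak (lsprod s_ge1 (fun i => Y i)))})
    (dF_null : forall x, S x ->
      [set h | stack s_ge1 (fun i => dF i xdag) h = 0] `<=`
      [set h | stack s_ge1 (fun i => dF i x) h = 0])
    (* random indices *)
    (d : measure_display) (T : measurableType d) (P : probability T R)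
    (idx : nat -> T -> 'I_N) (idx_iid : iid_uniform P (fun k => idx k.+1)) :
  let x_ k w := sgd p q F dF y jp mu x0 (idx^~ w) k in
  [/\ ('E_P[fun w => bregman p q (x_ k w) xdag] @[k --> \oo] --> 0)%E,
      forall r, 1 <= r <= p ->
        ('E_P[fun w => (`|x_ k w - xdag| `^ r)%R] @[k --> \oo] --> 0)%E &
      ('E_P[fun w => (`|J p (x_ k w) - J p xdag| `^ q)%R] @[k --> \oo] --> 0)%E].
Proof.
have q_gt1 : 1 < q by exact: conjugate_gt1 p_gt1 pq_conj.
have p_gt0 : 0 < p by exact: lt_trans p_gt1.
have q_gt0 : 0 < q by exact: lt_trans q_gt1.
pose Lmax := \big[Num.max/0]_(i < N) L i.
have {}dF_bound i x : S x -> `|dF i x| <= Lmax.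
  by move=> Sx; apply: le_trans (dF_bound i x Sx) _; exact: le_bigmax.
have [/ltW gamma_ge0 gamma_lt1] := andP gamma_01.
pose B x := bregman p q x xdag.
have B_ge0 x : 0 <= B x by exact: (bregman_ge0 p_gt1 pq_conj G_gt0 X_smooth G_bound).
have [[xdag_eq xdag_in] xdag_inf] := xdag_min.
have xdag_sol i : F i xdag = y i by rewrite -xdag_eq.
have {}xdag_min z : S z -> (forall i, F i z = y i) ->
    bregman p q x0 xdag <= bregman p q x0 z.
  move=> Sz Fz; rewrite xdag_inf; apply: ge_inf.
    exists 0 => _ [u _ <-].
    exact: (bregman_ge0 p_gt1 pq_conj G_gt0 X_smooth G_bound).
  by exists z => //; split=> //; apply: functional_extensionality_dep.
have {}dF_null z h : S z -> (forall i, dF i xdag h = 0) ->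
    forall i, dF i z h = 0.
  move=> Sz h0 i; have /(congr1 (fun f => f i)) := dF_null z Sz h
    (functional_extensionality_dep h0).
  exact.
pose step k x i : X :=
  of_bidual (J q (J p x - mu k.+1 *: adjoint (dF i x) (jp i (F i x - y i)))).
have stepP k x i : dual_step (F := F) (y := y) (dF := dF) (jp := jp)
    (p := p) (mu k.+1) i x (step k x i).
  exact: (J_of_bidual p_gt1 pq_conj G_gt0 X_convex X_smooth G_bound).
have sgdE w k : sgd p q F dF y jp mu x0 (idx^~ w) k =
    iteration step x0 (fun j => idx j.+1 w) k.
  elim: k => [|k IHk]; first by reflexivity.
  have -> : sgd p q F dF y jp mu x0 (idx^~ w) k.+1 =
      step k (sgd p q F dF y jp mu x0 (idx^~ w) k) (idx k.+1 w) by reflexivity.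
  by rewrite IHk.
have mu0 k : 0 < mu k.+1 by exact: mu_gt0.
have muC k : C <= 1 - gamma - Lmax `^ q * (G / q) * mu k.+1 `^ (q - 1).
  exact: mu_bound.
have descent k x i : bregman_ball p q nu xdag x ->
    B (step k x i) <= B x - C * (mu k.+1 * `|F i x - y i| `^ p).
  move=> xb; exact: (bregman_descent p_gt1 pq_conj G_gt0 X_smooth G_bound
    jp_selection dF_bound tangential_cone _ _ _ _ _ _ (muC k) (mu0 k)
    (ball_sub _ xb) xdag_in (xdag_sol i) (stepP k x i)).
have ball_step k x i : bregman_ball p q nu xdag x ->
    bregman_ball p q nu xdag (step k x i).
  move=> xb; apply: le_trans (descent k x i xb) _; apply: le_trans xb.
  by rewrite gerBl !mulr_ge0 ?powR_ge0// ltW.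
have ball_x w k : bregman_ball p q nu xdag
    (iteration step x0 (fun j => idx j.+1 w) k).
  by elim: k => [|k IHk]; [exact: x0_ball|exact: ball_step].
pose cost k x := mu k.+1 * residual (F := F) (y := y) x `^ p.
have cost_ge0 k x : 0 <= cost k x by rewrite mulr_ge0 ?powR_ge0// ltW.
(* The mean of [B] telescopes: averaging the descent over the next index
   brings in the residuals of all indices, with weight [N^-1]. *)
have mean_cost n : \sum_(0 <= k < n) mean step x0 k (cost k) <= N%:R / C * nu.
  have N0 : 0 < N%:R :> R by rewrite ltr0n.
  have mean_step k : C / N%:R * mean step x0 k (cost k) + mean step x0 k.+1 B
      <= mean step x0 k B.
    pose a := \sum_(i < N) mean step x0 k
      (fun x => mu k.+1 * `|F i x - y i| `^ p).
    have mc : mean step x0 k (cost k) <= a.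
      rewrite /a -mean_sum; apply: (mean_le _ _ (fun=> True)) => // x _.
      by rewrite -mulr_sumr ler_pM2l// residual_powR_le.
    have mB : mean step x0 k.+1 B <=
        N%:R^-1 * (- C * a + N%:R * mean step x0 k B).
      rewrite meanS card_ord ler_pM2l ?invr_gt0// /a mulr_sumr.
      rewrite mulr_natl -[X in _ *+ X](card_ord N) -sumr_const -big_split/=.
      apply: ler_sum => i _; rewrite -mean_linear.
      apply: (mean_le _ _ (bregman_ball p q nu xdag)) => // x xb.
      by rewrite mulNr addrC; exact: descent.
    have -> : mean step x0 k B =
        C / N%:R * a + N%:R^-1 * (- C * a + N%:R * mean step x0 k B).
      by field; rewrite gt_eqF.
    by apply: lerD => //; rewrite ler_pM2l// divr_gt0.
  have sum_cost : C / N%:R * \sum_(0 <= k < n) mean step x0 k (cost k) +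
      mean step x0 n B <= nu.
    elim: n => [|n IHn]; first by rewrite big_geq// mulr0 add0r.
    rewrite big_nat_recr// [X in C / _ * X]/= mulrDr -addrA.
    by apply: le_trans IHn; rewrite lerD2l.
  have {}sum_cost : C / N%:R * \sum_(0 <= k < n) mean step x0 k (cost k) <= nu.
    by apply: le_trans sum_cost; rewrite lerDl mean_ge0.
  rewrite -(@ler_pM2l _ (C / N%:R)) ?divr_gt0//; apply: (le_trans sum_cost).
  by rewrite mulrA [X in X * nu](_ : _ = 1) ?mul1r//; field; rewrite !gt_eqF.
have B_ae : {ae P, forall w,
    B (iteration step x0 (fun j => idx j.+1 w) k) @[k --> \oo] --> (0 : R)}.
  have := mean_summable_ae step x0 d T P _ idx_iid cost _ cost_ge0 mean_cost.
  apply: filterS => w [M costM].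
  apply: (bregman_orbit_cvg p_gt1 pq_conj G_gt0 X_smooth G_bound
    jp_selection dF_bound gamma_ge0 gamma_lt1 tangential_cone C_gt0 mu0 muC
    xdag_in xdag_sol ball_sub x0_ball _ S_closed dF_null xdag_min _ M costM).
    by move=> k; exact: stepP.
  exact: pinfty_series_gt.
pose c := (p * G `^ (p - 1))^-1.
have c0 : 0 < c by rewrite invr_gt0 mulr_gt0// powR_gt0.
have B_ge x : c * `|x - xdag| `^ p <= B x.
  exact: (bregman_ge p_gt1 pq_conj G_gt0 X_smooth G_bound).
have B_norm x : `|x - xdag| <= (B x / c) `^ p^-1.
  have -> : `|x - xdag| = (`|x - xdag| `^ p) `^ p^-1.
    by rewrite -powRrM mulfV ?gt_eqF// powRr1.
  have Bc : `|x - xdag| `^ p <= B x / c.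
    by rewrite ler_pdivlMr// mulrC.
  have Bc0 : 0 <= B x / c by exact: le_trans (powR_ge0 _ _) Bc.
  apply: ge0_ler_powR; rewrite ?nnegrE ?powR_ge0//.
  by rewrite invr_ge0 ltW.
have norm_ae : {ae P, forall w,
    `|iteration step x0 (fun j => idx j.+1 w) k - xdag| @[k --> \oo] --> (0 : R)}.
  apply: filterS B_ae => w Bw.
  have p1 : 0 < p^-1 by rewrite invr_gt0.
  have Bc : (B (iteration step x0 (fun j => idx j.+1 w) k) / c) `^ p^-1
      @[k --> \oo] --> (0 : R).
    rewrite -[X in _ --> X](powR0 (lt0r_neq0 p1)).
    apply: cvg_powR => //; first by move=> n; rewrite divr_ge0// ltW.
    by rewrite -(mul0r c^-1); apply: cvgMl.
  apply: (squeeze_cvgr _ (cvg_cst 0) Bc); apply: nearW => k.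
  by rewrite normr_ge0 B_norm.
pose rho := (nu / c) `^ p^-1.
have norm_le x : bregman_ball p q nu xdag x -> `|x - xdag| <= rho.
  move=> xb; apply: le_trans (B_norm x) _.
  have xnu : B x / c <= nu / c by rewrite ler_pM2r// invr_gt0.
  apply: ge0_ler_powR => //; first by rewrite invr_ge0 ltW.
    by rewrite nnegrE divr_ge0// ltW.
  by rewrite nnegrE divr_ge0// ltW.
have mfun k (psi : X -> R) : measurable_fun setT
    (fun w => psi (iteration step x0 (fun j => idx j.+1 w) k)).
  exact: (measurable_fun_iteration step x0 d T P _ idx_iid).
move=> x_.
have {x_} -> : x_ = (fun k w => iteration step x0 (fun j => idx j.+1 w) k).
  by apply/funext => k; apply/funext => w; exact: sgdE.
split.
- apply: (expectation_bounded_cvg0 _ _ P _ nu _ _ B_ae).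
    by move=> k; exact: (mfun k B).
  by move=> k w; apply/andP; split; [exact: B_ge0|exact: ball_x].
- move=> r /andP[r1 rp]; have r0 : 0 < r by exact: lt_le_trans r1.
  apply: (expectation_bounded_cvg0 _ _ P _ (rho `^ r)).
  + by move=> k; exact: (mfun k (fun x => `|x - xdag| `^ r)).
  + move=> k w; rewrite powR_ge0/=; apply: ge0_ler_powR; first exact: ltW.
    * by rewrite nnegrE.
    * by rewrite nnegrE powR_ge0.
    * exact: norm_le.
  + apply: filterS norm_ae => w xw.
    rewrite -[X in _ --> X](powR0 (lt0r_neq0 r0)).
    exact: cvg_powR.
- pose M := (rho + `|xdag|) `^ (p - 1) + `|xdag| `^ (p - 1).
  have p10 : 0 <= p - 1 by rewrite subr_ge0 ltW.
  apply: (expectation_bounded_cvg0 _ _ P _ (M `^ q)).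
  + by move=> k; exact: (mfun k (fun x => `|J p x - J p xdag| `^ q)).
  + move=> k w; rewrite powR_ge0/=; apply: ge0_ler_powR; first exact: ltW.
    * by rewrite nnegrE.
    * by rewrite nnegrE addr_ge0// powR_ge0.
    * apply: (le_trans (ler_normB _ _)); rewrite !J_norm// lerD2r.
      apply: ge0_ler_powR => //; rewrite ?nnegrE//.
        by rewrite addr_ge0// powR_ge0.
      rewrite -[X in `|X|](subrK xdag) (le_trans (ler_normD _ _))// lerD2r.
      exact: norm_le.
  + apply: filterS norm_ae => w xw.
    rewrite -[X in _ --> X](powR0 (lt0r_neq0 q_gt0)).
    apply: cvg_powR => //; apply: J_cvg => //.
    by apply/subr_cvg0/norm_cvg0P.
Qed.
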